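(* Let $G$ be a compact (Hausdorff) topological group. Then every BN-pair $(B,N)$ for $G$ is spherical, i.e. its Weyl group $W=N/(B\cap N)$ is finite. Here $B$ and $N$ are arbitrary abstract subgroups satisfying the BN-pair axioms; they are not assumed to be closed in $G$.
   Context: A BN-pair for a group $G$ is a pair of subgroups $B,N$ generating $G$ such that $T:=B\cap N$ is normal in $N$ and $W:=N/T$ is generated by a finite set $S$ of involutions satisfying the usual axioms ($sBw\subseteq BwB\cup BswB$ and $sBs\neq B$ for $s\in S$, $w\in W$). All BN-pairs are assumed to have finite rank ($S$ finite). The BN-pair is called spherical if $W$ is finite. *)

(* Defs.v *)
From Stdlib Require Import List.
Import ListNotations.

Record Group := {
  carrier :> Type;
  gmul : carrier -> carrier -> carrier;
  ginv : carrier -> carrier;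
  gone : carrier;
  gmulA : forall x y z, gmul x (gmul y z) = gmul (gmul x y) z;
  gmul1 : forall x, gmul gone x = x;
  gmulV : forall x, gmul (ginv x) x = gone
}.

Arguments gmul {g} _ _.
Arguments ginv {g} _.
Arguments gone {g}.

Definition is_subgroup {G : Group} (H : G -> Prop) : Prop :=
  H gone /\ (forall x y, H x -> H y -> H (gmul x y)) /\
  (forall x, H x -> H (ginv x)).

Definition generated {G : Group} (A : G -> Prop) (x : G) : Prop :=
  forall H : G -> Prop, is_subgroup H -> (forall a, A a -> H a) -> H x.

(** * BN-pairs (finite rank), with W = N/T represented via coset representatives *)
Section BN.
Context {G : Group}.

Definition BNT (B N : G -> Prop) (x : G) : Prop := B x /\ N x.

Definition dcoset (B : G -> Prop) (n : G) (x : G) : Prop :=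
  exists b1 b2, B b1 /\ B b2 /\ x = gmul (gmul b1 n) b2.

Definition conj_set (B : G -> Prop) (s : G) (x : G) : Prop :=
  exists b, B b /\ x = gmul (gmul s b) s.

(* (B, N) is a BN-pair for G whose Weyl group W = N/T is generated by
   the images of the finite list S of elements of N (each of which
   maps to an involution of W). *)
Definition is_BN_pair (B N : G -> Prop) (S : list G) : Prop :=
  is_subgroup B /\ is_subgroup N /\
  (forall x : G, generated (fun y => B y \/ N y) x) /\
  (forall n t, N n -> BNT B N t -> BNT B N (gmul (gmul n t) (ginv n))) /\
  (forall s, In s S -> N s /\ ~ BNT B N s /\ BNT B N (gmul s s)) /\
  (forall n, N n -> generated (fun y => In y S \/ BNT B N y) n) /\
  (forall s w b, In s S -> N w -> B b ->
     dcoset B w (gmul (gmul s b) w) \/ dcoset B (gmul s w) (gmul (gmul s b) w)) /\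
  (forall s, In s S -> ~ (forall x, conj_set B s x <-> B x)).

Definition weyl_finite (B N : G -> Prop) : Prop :=
  exists l : list G, forall n, N n ->
    exists w, In w l /\ N w /\ BNT B N (gmul (ginv w) n).

Definition spherical (B N : G -> Prop) : Prop := weyl_finite B N.
End BN.

Record TopGroup := {
  tgroup :> Group;
  is_open : (tgroup -> Prop) -> Prop;
  open_full : is_open (fun _ => True);
  open_union : forall (I : Type) (F : I -> tgroup -> Prop),
      (forall i, is_open (F i)) -> is_open (fun x => exists i, F i x);
  open_inter : forall U V, is_open U -> is_open V ->
      is_open (fun x => U x /\ V x);
  mul_continuous : forall (U : tgroup -> Prop) (x y : tgroup),
      is_open U -> U (gmul x y) ->
      exists V W, is_open V /\ is_open W /\ V x /\ W y /\
        (forall a b, V a -> W b -> U (gmul a b));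
  inv_continuous : forall U : tgroup -> Prop,
      is_open U -> is_open (fun x => U (ginv x))
}.

Definition hausdorff (G : TopGroup) : Prop :=
  forall x y : G, x <> y ->
    exists U V, is_open G U /\ is_open G V /\ U x /\ V y /\
      (forall z, U z -> V z -> False).

Definition compact (G : TopGroup) : Prop :=
  forall (I : Type) (F : I -> G -> Prop),
    (forall i, is_open G (F i)) ->
    (forall x : G, exists i, F i x) ->
    exists l : list I, forall x : G, exists i, In i l /\ F i x.

(* Main.v *)
From Stdlib Require Import List ssreflect Arith ZArith Lia Classical ClassicalEpsilon.
From Stdlib Require Import Reals Lra FunctionalExtensionality PropExtensionality ProofIrrelevance.
From mathcomp Require filter.
Require Import Defs.
Import ListNotations.
Local Open Scope nat_scope.

(** Let [W] be infinite and let [c] be the product of the simple reflections.  The geometric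
    representation shows that [c] has infinite order (otherwise the average over the powers of [c]
    vanishes on all roots, so every root changes sign along [<c>], and there are finitely many
    roots).  Lift [c] to [n] in [N].  Retracting the building onto the apartment from the repelling
    end of [n], and counting with signs the walls that separate the two ends of [c], gives a
    homomorphism from the centralizer of [n] to the integers that does not vanish at [n].  In a
    compact group no such homomorphism exists: [n] is a quotient [a b^-1] of commuting elements of
    its centralizer, where [a] is divisible by all powers of 2 and [b] by all powers of 3 (limits of
    powers of [n] with exponents [4 ^ (3 ^ J)] and [4 ^ (3 ^ J) - 1]), so that [a] and [b] are sent
    to 0. *)

(** * Groups and ultrafilters *)

(* As [B] and [N] need not be closed, the homomorphism on the centralizer carries no continuity:
   compactness can act only through algebra, by supplying roots. These roots are limits of powers of
   [n]; they commute with [n] but need not lie in [N], so the homomorphism must be defined on the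
   whole centralizer of [n] in [G], and the building is involved, not only [W]. An element of the
   centralizer induces on the retracted apartment a shift that commutes with a power of [w], and a
   change of base point can alter this shift by a reflection with the same property. The wall of
   such a reflection is preserved by a power of [w], so it does not separate the two ends; counting
   only separating walls is what makes the count independent of the base point and additive. The
   exponents [4 ^ (3 ^ J)] tend to 0 in the 2-adic and to 1 in the 3-adic integers, hence the two
   kinds of divisibility with [a = n * b]. *)
Declare Scope grp_scope.
Delimit Scope grp_scope with grp.
Bind Scope grp_scope with carrier.
Infix "*" := gmul : grp_scope.
Notation "1" := gone : grp_scope.
Notation "x ^-1" := (ginv x) (at level 3, left associativity, format "x ^-1") : grp_scope.
Local Open Scope grp_scope.

Section GroupLaws.
Context {G : Group}.
Implicit Types x y z : G.

Lemma gmulVr x : x * x^-1 = 1.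
Proof.
rewrite -(gmul1 _ (x * x^-1)) -{1}(gmulV _ (x^-1)) -gmulA (gmulA _ (x^-1)) gmulV gmul1.
exact: gmulV.
Qed.

Lemma gmulr1 x : x * 1 = x.
Proof. by rewrite -(gmulV _ x) gmulA gmulVr gmul1. Qed.

Lemma gmulKl x y : x^-1 * (x * y) = y.
Proof. by rewrite gmulA gmulV gmul1. Qed.

Lemma gmulKVl x y : x * (x^-1 * y) = y.
Proof. by rewrite gmulA gmulVr gmul1. Qed.

Lemma gmul_injl x y z : x * y = x * z -> y = z.
Proof. by move=> E; rewrite -(gmulKl x y) E gmulKl. Qed.

Lemma gmul_injr x y z : y * x = z * x -> y = z.
Proof.
by move=> E; rewrite -(gmulr1 y) -(gmulVr x) gmulA E -gmulA gmulVr gmulr1.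
Qed.

Lemma ginv_uniq x y : x * y = 1 -> x^-1 = y.
Proof. by move=> E; apply: (gmul_injl x); rewrite gmulVr E. Qed.

Lemma ginvM x y : (x * y)^-1 = y^-1 * x^-1.
Proof. by apply: ginv_uniq; rewrite -gmulA gmulKVl gmulVr. Qed.

Lemma ginvK x : x^-1^-1 = x.
Proof. by apply: ginv_uniq; rewrite gmulV. Qed.

Lemma ginv1 : (1 : G)^-1 = 1.
Proof. by apply: ginv_uniq; rewrite gmul1. Qed.

Fixpoint gpow x (n : nat) : G := if n is S m then x * gpow x m else 1.

Fixpoint gprod (l : list G) : G := if l is x :: l' then x * gprod l' else 1.

End GroupLaws.

Infix "^" := gpow : grp_scope.

#[local] Hint Rewrite @gmul1 @gmulr1 @gmulV @gmulVr @gmulKl @gmulKVl @ginvM @ginvK @ginv1 : grp.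
#[local] Hint Rewrite <- @gmulA : grp.
Ltac grp := autorewrite with grp; try reflexivity.

Section Powers.
Context {G : Group}.
Implicit Types x y z : G.

Lemma gpowD x m n : x ^ (m + n) = x ^ m * x ^ n.
Proof. by elim: m => [|m IH] /=; [grp | rewrite IH; grp]. Qed.

Lemma gpowS x n : x ^ (S n) = x ^ n * x.
Proof. by rewrite -Nat.add_1_r gpowD /=; grp. Qed.

Lemma gpow_mul x m n : x ^ (m * n)%nat = (x ^ m) ^ n.
Proof.
elim: n => [|n IH]; first by rewrite Nat.mul_0_r.
by rewrite Nat.mul_succ_r Nat.add_comm gpowD IH.
Qed.

Lemma comm_pow x y n : x * y = y * x -> x * y ^ n = y ^ n * x.
Proof.
move=> E; elim: n => [|n IH] /=; first by grp.
by rewrite gmulA E -gmulA IH gmulA.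
Qed.

Lemma comm_inv x y : x * y = y * x -> x * y^-1 = y^-1 * x.
Proof. by move=> E; apply: (gmul_injl y); rewrite gmulA -E; grp. Qed.

Lemma comm_mul x y z : x * y = y * x -> x * z = z * x -> x * (y * z) = y * z * x.
Proof. by move=> E E'; rewrite gmulA E -gmulA E' gmulA. Qed.

Lemma comm_conj x y z : x * y = y * x -> x * z = z * x ->
  x * (y * z * y^-1) = y * z * y^-1 * x.
Proof.
move=> E E'; apply: comm_mul; [exact: comm_mul | exact: comm_inv].
Qed.

Lemma gprod_app (l m : list G) : gprod (l ++ m) = gprod l * gprod m.
Proof. by elim: l => [|x l IH] /=; [grp | rewrite IH; grp]. Qed.

End Powers.

(** * Nonprincipal ultrafilters on the natural numbers and ultralimits *)

Record ultrafilter (U : (nat -> Prop) -> Prop) : Prop := {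
  uf_sup : forall P Q : nat -> Prop, U P -> (forall n, P n -> Q n) -> U Q;
  uf_and : forall P Q : nat -> Prop, U P -> U Q -> U (fun n => P n /\ Q n);
  uf_or : forall P : nat -> Prop, U P \/ U (fun n => ~ P n);
  uf_tail : forall k, U (fun n => k <= n);
  uf_ex : forall P : nat -> Prop, U P -> exists n, P n
}.

Lemma ultrafilter_exists : exists U, ultrafilter U.
Proof.
pose F (A : nat -> Prop) := exists k, forall n, k <= n -> A n.
have PF : filter.ProperFilter F.
  split; first by case=> k /(_ k (le_n k)).
  split.
  - by exists 0.
  - move=> P Q [k Hk] [l Hl]; exists (k + l) => n Hn.
    by split; [apply: Hk | apply: Hl]; lia.
  - by move=> P Q PQ [k Hk]; exists k => n Hn; apply/PQ/Hk.
have [U [UU sub]] := @filter.ultraFilterLemma nat F PF.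
have PU : filter.ProperFilter U := @filter.ultra_proper _ _ UU.
have FU : filter.Filter U := @filter.filter_filter _ _ PU.
exists U; split.
- by move=> P Q HP PQ; apply: (@filter.filterS _ _ FU _ _ PQ HP).
- by move=> P Q HP HQ; apply: (@filter.filterI _ _ FU _ _ HP HQ).
- by move=> P; exact: (@filter.in_ultra_setVsetC _ _ P UU).
- by move=> k; apply: sub; exists k.
- move=> P HP; apply: NNPP => H; apply: (@filter.filter_not_empty _ _ PU).
  by apply: (@filter.filterS _ _ FU _ _ _ HP) => n Pn; case: H; exists n.
Qed.

Section Ultralimits.
Context {U : (nat -> Prop) -> Prop} (UF : ultrafilter U).

Definition ulim {X : Type} (x : nat -> X) (v : X) : Prop := U (fun n => x n = v).

Lemma uf_all (P : nat -> Prop) : (forall n, P n) -> U P.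
Proof. by move=> H; apply: (uf_sup U UF _ _ (uf_tail U UF 0)). Qed.

Lemma ulim_uniq {X : Type} (x : nat -> X) u v : ulim x u -> ulim x v -> u = v.
Proof.
move=> Hu Hv; have [n [<- <-]] := uf_ex U UF _ (uf_and U UF _ _ Hu Hv).
by [].
Qed.

Lemma ulim_ext {X : Type} (x y : nat -> X) v :
  U (fun n => x n = y n) -> ulim x v -> ulim y v.
Proof.
move=> E H; apply: (uf_sup U UF _ _ (uf_and U UF _ _ E H)) => n [-> //].
Qed.

Lemma ulim_map2 {X Y Z : Type} (f : X -> Y -> Z) x y u v :
  ulim x u -> ulim y v -> ulim (fun n => f (x n) (y n)) (f u v).
Proof.
move=> Hu Hv; apply: (uf_sup U UF _ _ (uf_and U UF _ _ Hu Hv)).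
by move=> n [-> ->].
Qed.

Lemma ulim_finite {X : Type} (l : list X) (x : nat -> X) :
  U (fun n => In (x n) l) -> exists2 v, In v l & ulim x v.
Proof.
elim: l => [|a l IH] H; first by have [n []] := uf_ex U UF _ H.
have [Ha|Ha] := uf_or U UF (fun n => x n = a); first by exists a; [left|].
have [|v vl Hv] := IH; last by exists v => //; right.
by apply: (uf_sup U UF _ _ (uf_and U UF _ _ H Ha)) => n [[->|//] //].
Qed.

Lemma ulim_pigeonhole {X : Type} (l : list X) (x : nat -> X) :
  U (fun n => In (x n) l) -> exists m n, m < n /\ x m = x n.
Proof.
move=> /ulim_finite [v _ Hv].
have [m Hm] := uf_ex U UF _ Hv.
have [n [Hn mn]] := uf_ex U UF _ (uf_and U UF _ _ Hv (uf_tail U UF (S m))).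
by exists m, n; split; [lia | rewrite Hm Hn].
Qed.

End Ultralimits.

(** * Coxeter groups and the flux homomorphism *)

(** Coxeter groups through their length function, with the folding condition [cl_fold] in place of a
    presentation: this is what the BN-axioms yield directly, and the exchange condition follows from
    it. *)
Record coxeter_length {W : Group} (Sg : W -> Prop) (len : W -> nat) : Prop := {
  cl_invol : forall s, Sg s -> s * s = 1;
  cl_zero : forall w, len w = 0 <-> w = 1;
  cl_step : forall w s, Sg s -> len (w * s) = S (len w) \/ len w = S (len (w * s));
  cl_desc : forall w, w <> 1 -> exists s, Sg s /\ len w = S (len (w * s));
  cl_inv : forall w, len w^-1 = len w;
  cl_fold : forall s w r, Sg s -> Sg r ->
    len (s * w) = S (len w) -> len (w * r) = S (len (s * w * r)) -> s * w = w * r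
}.

Section Coxeter.
Context {W : Group} {Sg : W -> Prop} {len : W -> nat} (CL : coxeter_length Sg len).
Implicit Types (g s t u w z : W) (x : list W).

Definition sign_if (P : Prop) : Z :=
  match excluded_middle_informative P with left _ => -1 | right _ => 1 end%Z.

(** The side of the wall of [g * s * g^-1] on which [g] lies: 1 on the side of the identity, -1 on
    the other. *)
Definition eps g s : Z := (Z.of_nat (len (g * s)) - Z.of_nat (len g))%Z.

Lemma gen_inv s : Sg s -> s^-1 = s.
Proof. by move=> Ss; apply/ginv_uniq/(cl_invol _ _ CL). Qed.

Lemma genK s g : Sg s -> s * (s * g) = g.
Proof. by move=> Ss; rewrite gmulA (cl_invol _ _ CL) // gmul1. Qed.

Lemma genKr s g : Sg s -> g * s * s = g.
Proof. by move=> Ss; rewrite -gmulA (cl_invol _ _ CL) // gmulr1. Qed.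

Lemma len1 : len 1 = 0.
Proof. exact/(cl_zero _ _ CL). Qed.

Lemma cl_step_left w s : Sg s -> len (s * w) = S (len w) \/ len w = S (len (s * w)).
Proof.
move=> Ss; rewrite -(cl_inv _ _ CL (s * w)) -(cl_inv _ _ CL w) ginvM (gen_inv s Ss).
exact: (cl_step _ _ CL).
Qed.

Lemma eps_sign g s : Sg s -> (eps g s = 1 \/ eps g s = -1)%Z.
Proof. by move=> Ss; rewrite /eps; case: (cl_step _ _ CL g s Ss); lia. Qed.

Lemma eps_flip g s : Sg s -> eps (g * s)%grp s = (- eps g s)%Z.
Proof. by move=> Ss; rewrite /eps genKr //; lia. Qed.

Lemma eps_one s : Sg s -> eps 1 s = 1%Z.
Proof.
by move=> Ss; case: (cl_step _ _ CL 1 s Ss); rewrite /eps len1; lia.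
Qed.

Lemma fold_eps r g s : Sg r -> Sg s ->
  eps g s = 1%Z -> eps (r * g)%grp s = (-1)%Z -> r = g * s * g^-1.
Proof.
move=> Sr Ss; rewrite /eps => E1 E2.
have H : r * g = g * s.
  apply: (cl_fold _ _ CL) => //.
  - by case: (cl_step_left g r Sr) (cl_step_left (g * s) r Sr); rewrite gmulA; lia.
  - by case: (cl_step_left g r Sr) (cl_step_left (g * s) r Sr); rewrite gmulA; lia.
by rewrite -H; grp.
Qed.

(** The identity and [r] are separated by the wall of [r] alone. A change of sign forces
    [r * g = g * s] by folding, applied to [g] or to [g * s] according to the direction of the
    change. *)
Lemma eps_gen_mul r g s : Sg r -> Sg s ->
  eps (r * g)%grp s = (sign_if (r = (g * s * g^-1)%grp) * eps g s)%Z.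
Proof.
move=> Sr Ss; rewrite /sign_if; case: excluded_middle_informative => [E|NE].
  have E' : r * g = g * s by rewrite E; grp.
  by rewrite E' eps_flip //; lia.
have [E1|E1] := eps_sign g s Ss; have [E2|E2] := eps_sign (r * g) s Ss;
  rewrite E1 E2 //; exfalso; apply: NE; first exact: fold_eps.
have -> : g * s * g^-1 = (g * s) * s * (g * s)^-1.
  by rewrite ginvM (gen_inv s Ss); grp; rewrite genK.
apply: fold_eps => //; first by rewrite eps_flip // E1.
by rewrite gmulA eps_flip // E2.
Qed.

(** The sign cocycle of the action of [W] on signed reflections; [flips x] lists the only
    reflections at which it can be -1. *)
Fixpoint chi x t : Z :=
  if x is r :: x' then
    sign_if (r = (gprod x' * t * (gprod x')^-1)%grp)
    * chi x' t
  else 1.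

Fixpoint flips x : list W :=
  if x is r :: x' then ((gprod x')^-1 * r * gprod x') :: flips x' else [].

Lemma eps_mul x g s : Forall Sg x -> Sg s ->
  eps (gprod x * g)%grp s = (chi x (g * s * g^-1)%grp * eps g s)%Z.
Proof.
move=> Fx Ss; elim: Fx => {x} [|r x Sr _ IH] /=; first by rewrite gmul1; case: (eps g s).
rewrite -gmulA eps_gen_mul // IH ginvM; grp.
by rewrite Z.mul_assoc.
Qed.

Lemma chi_flips x t : chi x t = 1%Z \/ In t (flips x).
Proof.
elim: x => [|r x [IH|IH]] /=; [by left | | by right; right].
rewrite /sign_if; case: excluded_middle_informative => [E|_]; last by left; rewrite IH.
by right; left; rewrite E; grp.
Qed.

Lemma eps_noflip x g s : Forall Sg x -> Sg s -> ~ In (g * s * g^-1) (flips x) ->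
  eps (gprod x * g) s = eps g s.
Proof.
move=> Fx Ss H; rewrite eps_mul //.
by case: (chi_flips x (g * s * g^-1)) => [->|//]; lia.
Qed.

Lemma flips_split x t : In t (flips x) ->
  exists x1 c x2, x = x1 ++ c :: x2 /\ t = (gprod x2)^-1 * c * gprod x2.
Proof.
elim: x => //= r x IH [<-|/IH [x1 [c [x2 [-> ->]]]]]; first by exists [], r, x.
by exists (r :: x1), c, x2.
Qed.

(** The sign at [r] is 1 at the identity and -1 at [gprod x], so [r] is among the [flips] of [x];
    the letter that flips it is the one to delete. *)
Lemma exchange x r : Forall Sg x -> Sg r -> eps (gprod x) r = (-1)%Z ->
  exists x1 c x2, x = x1 ++ c :: x2 /\ gprod x * r = gprod (x1 ++ x2).
Proof.
move=> Fx Sr E.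
have : In (1 * r * 1^-1) (flips x).
  apply: NNPP => H; move: (eps_noflip x 1 r Fx Sr H).
  by rewrite gmulr1 E eps_one.
move=> /flips_split [x1 [c [x2 [Ex Er]]]]; exists x1, c, x2; split=> //.
have Sc : Sg c by move: Fx; rewrite Ex Forall_app Forall_cons_iff => -[_ []].
have -> : r = (gprod x2)^-1 * c * gprod x2 by move: Er; grp.
by rewrite Ex !gprod_app /=; grp; rewrite genK.
Qed.

(** Conjugation by [k] fixes the reflection, so both factors [k] contribute the same sign, whose
    square is 1. *)
Lemma sqr_eps k g s : Sg s -> (exists2 x, Forall Sg x & gprod x = k) ->
  k * (g * s * g^-1) = (g * s * g^-1) * k -> eps (k * (k * g)) s = eps g s.
Proof.
move=> Ss [x Fx <-] E; rewrite !eps_mul //.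
have -> : gprod x * g * s * (gprod x * g)^-1 = g * s * g^-1.
  transitivity (gprod x * (g * s * g^-1) * (gprod x)^-1); first by grp.
  by rewrite E; grp.
have [->|->] : (chi x (g * s * g^-1) = 1 \/ chi x (g * s * g^-1) = -1)%Z; try lia.
elim: x {Fx E} => [|r x IH] /=; first by left.
by rewrite /sign_if; case: excluded_middle_informative => _; lia.
Qed.

Lemma reduced_word w : exists x, Forall Sg x /\ gprod x = w /\ length x = len w.
Proof.
move E: (len w) => n; elim: n w E => [|n IH] w E.
  by exists []; do 2 split=> //=; move: E => /(cl_zero _ _ CL).
have [|s [Ss Es]] := cl_desc _ _ CL w; first by move=> E'; move: E; rewrite E' len1.
have [|x [Fx [Ex Lx]]] := IH (w * s); first by lia.
exists (x ++ [s]); split; last split.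
- by apply/Forall_app; split=> //; constructor.
- by rewrite gprod_app Ex /=; grp; rewrite (cl_invol _ _ CL) //; grp.
- by rewrite length_app Lx /=; lia.
Qed.

Lemma word_ex w : exists2 x, Forall Sg x & gprod x = w.
Proof. by have [x [Fx [Ex _]]] := reduced_word w; exists x. Qed.

Lemma gen_ind (P : W -> Prop) :
  P 1 -> (forall w s, Sg s -> P w -> P (w * s)) -> forall w, P w.
Proof.
move=> P1 PS w; have [x Fx <-] := word_ex w.
elim/rev_ind: x Fx => [//|s x IH] /Forall_app [Fx /Forall_cons_iff [Ss _]].
by rewrite gprod_app /= gmulr1; apply: PS => //; apply: IH.
Qed.

Lemma len_gprod x : Forall Sg x -> len (gprod x) <= length x.
Proof.
elim/rev_ind: x => [|s x IH] /=; first by rewrite len1.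
move=> /Forall_app [Fx /Forall_cons_iff [Ss _]].
rewrite gprod_app length_app /= gmulr1.
by move: (IH Fx) (cl_step _ _ CL (gprod x) s Ss); lia.
Qed.

Lemma len_mul u v : len (u * v) <= len u + len v.
Proof.
have [x [Fx [<- <-]]] := reduced_word u; have [y [Fy [<- <-]]] := reduced_word v.
by rewrite -gprod_app -length_app; apply: len_gprod; apply/Forall_app.
Qed.

Lemma ball_finite (gens : list W) (Hg : forall s, Sg s <-> In s gens) n :
  exists l, forall w, len w <= n -> In w l.
Proof.
elim: n => [|n [l Hl]].
  by exists [1] => w H; left; symmetry; apply/(cl_zero _ _ CL); lia.
exists (1 :: flat_map (fun w => map (gmul w) gens) l) => w Hw.
have [->|/(cl_desc _ _ CL) [s [Ss Es]]] := classic (w = 1); [by left | right].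
apply/in_flat_map; exists (w * s); split; first by apply: Hl; lia.
by apply/in_map_iff; exists s; split; [exact: genKr | exact/Hg].
Qed.

(** * Walls along the powers of an element, and the flux *)

Section Flux.
Context {gens : list W} (Hgens : forall s, Sg s <-> In s gens) (w : W).
Context {U : (nat -> Prop) -> Prop} (UF : ultrafilter U).
Implicit Types (h : nat -> Z).

(* Factorial exponents, so that whatever commutes with some positive power of [w] commutes with
   all but finitely many of the [wfact J]. *)
Definition wfact (J : nat) : W := w ^ fact (S J).

Definition virt_central z : Prop := exists2 P, 0 < P & z * w ^ P = w ^ P * z.

Lemma commute_multiple z P m : z * w ^ P = w ^ P * z -> Nat.divide P m ->
  z * w ^ m = w ^ m * z.
Proof. by move=> E [q ->]; rewrite Nat.mul_comm gpow_mul; exact: comm_pow. Qed.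

Lemma divide_fact P n : 0 < P <= n -> Nat.divide P (fact n).
Proof.
elim: n => [|n IH] H; first by lia.
have [->|ne] := Nat.eq_dec P (S n); first exact: Nat.divide_factor_l.
by apply: Nat.divide_mul_r; apply: IH; lia.
Qed.

Lemma virt_central_wfact z : virt_central z -> exists K, forall J, K <= J ->
  z * wfact J = wfact J * z.
Proof.
move=> [P P0 E]; exists P => J PJ; apply: (commute_multiple _ P) => //.
by apply: divide_fact; lia.
Qed.

Lemma virt_centralM z z' : virt_central z -> virt_central z' -> virt_central (z * z').
Proof.
move=> [P P0 E] [Q Q0 E']; exists (P * Q)%nat; first by lia.
rewrite -gmulA (commute_multiple z' Q) //; last exact: Nat.divide_factor_r.
by rewrite gmulA (commute_multiple z P) ?gmulA //; exact: Nat.divide_factor_l.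
Qed.

Lemma virt_centralV z : virt_central z -> virt_central z^-1.
Proof. by move=> [P P0 E]; exists P => //; symmetry; exact: comm_inv. Qed.

Lemma conj_eq_comm (a b t : W) :
  a * t * a^-1 = b * t * b^-1 -> t * (a^-1 * b) = a^-1 * b * t.
Proof.
move=> E; transitivity (a^-1 * (a * t * a^-1) * b); first by grp.
by rewrite E; grp.
Qed.

Lemma gpow_sub m n : m < n -> (w ^ m)^-1 * w ^ n = w ^ (n - m).
Proof.
by move=> mn; have -> : n = m + (n - m) by [lia]; rewrite gpowD gmulKl; congr gpow; lia.
Qed.

Lemma conj_eq_virt_central t m n : m < n ->
  w ^ m * t * (w ^ m)^-1 = w ^ n * t * (w ^ n)^-1 -> virt_central t.
Proof.
move=> mn E; exists (n - m); first by lia.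
by move: (conj_eq_comm _ _ _ E); rewrite gpow_sub.
Qed.

Lemma conjV_eq_virt_central t m n : m < n ->
  (w ^ m)^-1 * t * (w ^ m)^-1^-1 = (w ^ n)^-1 * t * (w ^ n)^-1^-1 -> virt_central t.
Proof.
move=> mn E; exists (n - m); first by lia.
have -> : w ^ (n - m) = w ^ n * (w ^ m)^-1.
  have -> : w ^ n = w ^ (n - m) * w ^ m by rewrite -gpowD; congr gpow; lia.
  by grp.
by move: (conj_eq_comm _ _ _ (eq_sym E)); rewrite ginvK.
Qed.

(** [fact 0 = fact 1], hence the successors: from [fact 1] on, the exponents of [wfact] strictly
    increase. *)
Lemma fact_lt m n : m < n -> fact (S m) < fact (S n).
Proof.
elim: n => [|n IH] mn; first by lia.
have P := lt_O_fact (S n).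
have lt : fact (S n) < fact (S (S n)) by rewrite [fact (S (S n))]/=; move: P => /=; nia.
have [->//|ne] := Nat.eq_dec m n.
by apply: Nat.lt_trans lt; apply: IH; lia.
Qed.

Lemma injective_leaves {X : Type} (a : nat -> X) (l : list X) :
  (forall m n, m < n -> a m <> a n) -> exists K, forall k, K <= k -> ~ In (a k) l.
Proof.
move=> inj; elim: l => [|b l [K HK]]; first by exists 0 => k _ [].
have [[m Em]|N] := classic (exists m, a m = b).
  exists (S (K + m)) => k Hk [E|]; last by apply: HK; lia.
  by apply: (inj m k); [lia | rewrite Em E].
by exists K => k Hk [E|]; [apply: N; exists k | apply: HK].
Qed.

(** Two equal conjugates make [t] commute with a power of [w]; otherwise the conjugates are pairwise
    distinct and a finite list contains only finitely many of them. *)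
Lemma virt_central_or_leaves (t : W) (l : list W) :
  virt_central t \/ exists K, forall k, K <= k -> ~ In (w ^ k * t * (w ^ k)^-1) l.
Proof.
have [|N] := classic (virt_central t); [by left | right].
apply: (injective_leaves (fun k => w ^ k * t * (w ^ k)^-1)) => m n mn E.
by apply: N; apply: conj_eq_virt_central E.
Qed.

Definition evper h : Prop :=
  exists R K, 0 < R /\ forall k, K <= k -> h (k + R) = h k.

Lemma evper_shift h R K : (forall k, K <= k -> h (k + R) = h k) ->
  forall q k, K <= k -> h (k + q * R)%nat = h k.
Proof.
move=> H; elim=> [|q IH] k Hk; first by rewrite Nat.add_0_r.
by rewrite /= (Nat.add_comm R) Nat.add_assoc H; [exact: IH | lia].
Qed.

Lemma evperD h h' : evper h -> evper h' -> evper (fun n => h n + h' n)%Z.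
Proof.
move=> [R [K [R0 H]]] [R' [K' [R'0 H']]]; exists (R * R')%nat, (K + K'); split; first by lia.
move=> n Hn; rewrite (evper_shift h' R' K' H') ?(Nat.mul_comm R R'); last by lia.
by rewrite (evper_shift h R K H) //; lia.
Qed.

(** A wall preserved by [w ^ P] has period [P + P], because [sqr_eps] needs a square. For any other
    wall the conjugates leave the finite list of reflections that [w] can flip, and the sign is
    eventually constant. *)
Lemma evper_eps u s : Sg s -> evper (fun k => eps (w ^ k * u) s).
Proof.
move=> Ss; have [x Fx Ex] := word_ex w.
have [[P P0 E]|[K HK]] := virt_central_or_leaves (u * s * u^-1) (flips x); last first.
  exists 1%nat, K; split=> // k /HK H.
  rewrite Nat.add_1_r /= -gmulA -{1}Ex; apply: eps_noflip => //.
  by move: H; grp.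
exists (P + P), 0; split; first by lia.
move=> k _; have -> : w ^ (k + (P + P)) * u = w ^ P * (w ^ P * (w ^ k * u)).
  by rewrite Nat.add_comm !gpowD; grp.
apply: sqr_eps => //; first exact: word_ex.
have -> : w ^ k * u * s * (w ^ k * u)^-1 = w ^ k * (u * s * u^-1) * (w ^ k)^-1 by grp.
by apply: comm_conj; rewrite // -!gpowD Nat.add_comm.
Qed.

Lemma evper_len u : evper (fun k => Z.of_nat (len (w ^ k * u)) - Z.of_nat (len (w ^ k)))%Z.
Proof.
elim/gen_ind: u => [|u s Ss [R [K [R0 H]]]].
  by exists 1%nat, 0; split=> // k _; rewrite !gmulr1; lia.
have [R' [K' [R'0 H']]] : evper (fun k => (Z.of_nat (len (w ^ k * u)) - Z.of_nat (len (w ^ k)))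
  + eps (w ^ k * u) s)%Z.
  by apply: evperD (evper_eps u s Ss); exists R, K.
exists R', K'; split=> // k /H'; rewrite /eps !gmulA; lia.
Qed.

Lemma powers_unbounded : (forall n, 0 < n -> w ^ n <> 1) ->
  forall m, exists K, forall k, K <= k -> m < len (w ^ k).
Proof.
move=> inf m; have [l Hl] := ball_finite gens Hgens m.
have [|K HK] := injective_leaves (fun k => w ^ k) l.
  move=> i j ij E; apply: (inf (j - i)); first by lia.
  apply: (gmul_injl (w ^ i)); rewrite -gpowD gmulr1 E; congr gpow; lia.
by exists K => k /HK H; apply: NNPP => H'; apply: H; apply: Hl; lia.
Qed.

(** With [u = w], [evper_len] makes the increments of [len (w ^ k)] eventually periodic, so each
    period adds the same [d]; it is positive because balls in [W] are finite. *)
Lemma powers_growth : (forall n, 0 < n -> w ^ n <> 1) ->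
  exists R K d, 0 < R /\ (0 < d)%Z /\
    forall k, K <= k -> Z.of_nat (len (w ^ (k + R))) = (Z.of_nat (len (w ^ k)) + d)%Z.
Proof.
move=> inf; have [R [K [R0 H]]] := evper_len w.
pose a k := Z.of_nat (len (w ^ k)); pose d := (a (K + R)%nat - a K)%Z.
have Ha k : K <= k -> (a (S k + R)%nat - a (k + R)%nat = a (S k) - a k)%Z.
  by move=> /H; rewrite /a -!gpowS.
have Hd k : K <= k -> (a (k + R)%nat = a k + d)%Z.
  elim: k => [|k IH] Hk; first by have -> : 0 = K by [lia]; rewrite /d; lia.
  have [<-|ne] := Nat.eq_dec K (S k); first by rewrite /d; lia.
  by move: (IH ltac:(lia)) (Ha k ltac:(lia)); lia.
exists R, K, d; split; [|split] => //.
have Hq q : (a (K + q * R)%nat = a K + Z.of_nat q * d)%Z.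
  elim: q => [|q IH]; first by rewrite Nat.add_0_r; lia.
  have -> : K + S q * R = K + q * R + R by lia.
  by rewrite Hd ?IH; lia.
have [K' HK'] := powers_unbounded inf (len (w ^ K)).
move: (HK' (K + K' * R)%nat ltac:(nia)) (Hq K'); rewrite /a; nia.
Qed.

(** The distance of [u] from [(wfact J)^-1] minus its distance from [wfact J]: a difference of
    Busemann functions in the limit. *)
Definition side_defect (u : W) (J : nat) : Z :=
  (Z.of_nat (len (wfact J * u)) - Z.of_nat (len ((wfact J)^-1 * u)))%Z.

Definition eps_defect (u s : W) (J : nat) : Z :=
  (eps (wfact J * u) s - eps ((wfact J)^-1 * u) s)%Z.

Lemma side_defectS u s J :
  side_defect (u * s) J = (side_defect u J + eps_defect u s J)%Z.
Proof. by rewrite /side_defect /eps_defect /eps !gmulA; lia. Qed.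

Lemma side_defect1 J : side_defect 1 J = 0%Z.
Proof. by rewrite /side_defect !gmulr1 (cl_inv _ _ CL); lia. Qed.

Lemma side_defect_ulim u : exists v, ulim (U := U) (side_defect u) v.
Proof.
elim/gen_ind: u => [|u s Ss [v Hv]].
  by exists 0%Z; apply: uf_all => // J; exact: side_defect1.
have [|d _ Hd] := ulim_finite UF [0; 2; -2]%Z (eps_defect u s).
  apply: uf_all => // J; rewrite /eps_defect.
  by case: (eps_sign (wfact J * u) s Ss) (eps_sign ((wfact J)^-1 * u) s Ss)
    => -> [] -> /=; auto.
exists (v + d)%Z; apply: ulim_ext (ulim_map2 UF Z.add _ _ _ _ Hv Hd) => //.
by apply: uf_all => // J; rewrite side_defectS.
Qed.

(* Twice the signed number of the walls between [1] and [u] that separate the two ends of [w]. *)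
Definition flux (u : W) : Z :=
  epsilon (inhabits 0%Z) (ulim (U := U) (side_defect u)).

Lemma fluxP u : ulim (U := U) (side_defect u) (flux u).
Proof. exact: (epsilon_spec (inhabits 0%Z) _ (side_defect_ulim u)). Qed.

Lemma flux_eq u v : U (fun J => side_defect u J = v) -> flux u = v.
Proof. by move=> H; apply: ulim_uniq (fluxP u) H. Qed.

Lemma flux1 : flux 1 = 0%Z.
Proof. by apply: flux_eq; apply: uf_all => // J; exact: side_defect1. Qed.

(** The two points compared differ by the square of [wfact J], which for large [J] commutes with the
    reflection, so they lie on the same side. *)
Lemma eps_defect_periodic u s : Sg s -> virt_central (u * s * u^-1) ->
  U (fun J => eps_defect u s J = 0%Z).
Proof.
move=> Ss /virt_central_wfact [K HK].
apply: (uf_sup U UF _ _ (uf_tail U UF K)) => J /HK E.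
rewrite /eps_defect.
have -> : wfact J * u = wfact J * (wfact J * ((wfact J)^-1 * u)) by grp.
rewrite sqr_eps //; [lia | exact: word_ex |].
have -> : (wfact J)^-1 * u * s * ((wfact J)^-1 * u)^-1 = u * s * u^-1.
  transitivity ((wfact J)^-1 * (u * s * u^-1 * wfact J)); first by grp.
  by rewrite E gmulKl.
by [].
Qed.

Lemma ulim_not_in {X : Type} (a : nat -> X) (l : list X) :
  (forall m n, m < n -> a m <> a n) -> U (fun J => ~ In (a J) l).
Proof.
move=> inj; have [K HK] := injective_leaves a l inj.
by apply: (uf_sup U UF _ _ (uf_tail U UF K)).
Qed.

(** Once moved to the left of [c J], the factor [z] flips only finitely many reflections, and the
    conjugates by [c J] eventually avoid these. *)
Lemma eps_central (c : nat -> W) z u s : Sg s ->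
  (exists K, forall J, K <= J -> z * c J = c J * z) ->
  (forall m n, m < n ->
    c m * (u * s * u^-1) * (c m)^-1 <> c n * (u * s * u^-1) * (c n)^-1) ->
  U (fun J => eps (c J * (z * u)) s = eps (c J * u) s).
Proof.
move=> Ss [K HK] inj; have [x Fx Ex] := word_ex z.
have H := ulim_not_in _ (flips x) inj.
apply: (uf_sup U UF _ _ (uf_and U UF _ _ H (uf_tail U UF K))) => J [NJ /HK E].
rewrite gmulA -E -gmulA -Ex; apply: eps_noflip => //.
by move: NJ; grp.
Qed.

Lemma eps_defect_central z u s : virt_central z -> Sg s ->
  U (fun J => eps_defect (z * u) s J = eps_defect u s J).
Proof.
move=> Hz Ss.
have [V|NV] := classic (virt_central (u * s * u^-1)).
  have V' : virt_central (z * u * s * (z * u)^-1).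
    have -> : z * u * s * (z * u)^-1 = z * (u * s * u^-1) * z^-1 by grp.
    by apply: virt_centralM (virt_centralV _ Hz); exact: virt_centralM.
  move: (uf_and U UF _ _ (eps_defect_periodic _ _ Ss V) (eps_defect_periodic _ _ Ss V')).
  by move/(uf_sup U UF); apply=> J [-> ->].
have [K HK] := virt_central_wfact z Hz.
have H1 := eps_central wfact z u s Ss (ex_intro _ K HK).
have H2 := eps_central (fun J => (wfact J)^-1) z u s Ss.
have E1 : U (fun J => eps (wfact J * (z * u)) s = eps (wfact J * u) s).
  apply: H1 => m n mn E; apply: NV.
  exact: conj_eq_virt_central (fact_lt _ _ mn) E.
have E2 : U (fun J => eps ((wfact J)^-1 * (z * u)) s = eps ((wfact J)^-1 * u) s).
  apply: H2; first by exists K => J /HK; exact: comm_inv.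
  move=> m n mn E; apply: NV.
  exact: conjV_eq_virt_central (fact_lt _ _ mn) E.
apply: (uf_sup U UF _ _ (uf_and U UF _ _ E1 E2)) => J [E E'].
by rewrite /eps_defect E E'.
Qed.

(** Induction on [u]: appending [s] changes [flux (z * u)] and [flux u] by the limit of the same
    defect. *)
Lemma flux_mul z u : virt_central z -> flux (z * u) = (flux z + flux u)%Z.
Proof.
move=> Hz; elim/gen_ind: u => [|u s Ss IH]; first by rewrite gmulr1 flux1; lia.
apply: flux_eq; rewrite gmulA.
have H := uf_and U UF _ _ (fluxP (z * u)) (uf_and U UF _ _ (fluxP u)
  (uf_and U UF _ _ (fluxP (u * s)) (eps_defect_central z u s Hz Ss))).
apply: (uf_sup U UF _ _ H) => J [E1 [E2 [E3 E4]]].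
by rewrite side_defectS E1 E4 -E3 side_defectS E2 IH; lia.
Qed.

Lemma flux_pow z n : virt_central z -> flux (z ^ n) = (Z.of_nat n * flux z)%Z.
Proof.
move=> Hz; elim: n => [|n IH]; first exact: flux1.
by rewrite Nat2Z.inj_succ /= flux_mul // IH; lia.
Qed.

Lemma flux_involution t : virt_central t -> t * t = 1 -> flux t = 0%Z.
Proof. by move=> Ht E; move: (flux_mul t t Ht); rewrite E flux1; lia. Qed.

Lemma virt_central_self : virt_central w.
Proof. by exists 1%nat => //=; grp. Qed.

(** The defect of [w ^ R] compares the powers with exponents [fact (S J) + R] and [fact (S J) - R],
    two periods apart, whence the value [2 * d]. *)
Lemma flux_self_neq0 : (forall n, 0 < n -> w ^ n <> 1) -> flux w <> 0%Z.
Proof.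
move=> /powers_growth [R [K [d [R0 [d0 H]]]]] F0.
suff : flux (w ^ R) = (2 * d)%Z.
  by rewrite flux_pow ?F0; [lia | exact: virt_central_self].
apply: flux_eq; apply: (uf_sup U UF _ _ (uf_tail U UF (K + R))) => J HJ.
have HJ' : K + R <= fact (S J).
  suff : J <= fact J by move=> ?; have := fact_lt; rewrite /=; nia.
  by elim: (J) => [|j IH] /=; [lia | have := lt_O_fact j; nia].
rewrite /side_defect /wfact -gpowD.
have -> : (w ^ fact (S J))^-1 * w ^ R = (w ^ (fact (S J) - R))^-1.
  have {1}-> : fact (S J) = R + (fact (S J) - R) by lia.
  by rewrite gpowD; grp.
rewrite (cl_inv _ _ CL) H; last by lia.
have {1}-> : fact (S J) = (fact (S J) - R) + R by lia.
by rewrite H; lia.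
Qed.

End Flux.
End Coxeter.

(** * The numbers game *)

Section Chebyshev.
Context (kappa : R).

(** Chebyshev polynomials of the second kind in [kappa / 2], with the index shifted by one. *)
Fixpoint cheb (k : nat) : R :=
  match k with
  | 0 => 0
  | S k' => match k' with 0 => 1 | S k'' => kappa * cheb k' - cheb k'' end
  end%R.

Lemma chebSS k : cheb (S (S k)) = (kappa * cheb (S k) - cheb k)%R.
Proof. by []. Qed.

(** The value -1 comes from running the recursion one step below index 0. *)
Definition cheb_pred (k : nat) : R := if k is S k' then cheb k' else (-1)%R.

Lemma cheb_predE k : cheb (S k) = (kappa * cheb k - cheb_pred k)%R.
Proof. by case: k => [|k] /=; [lra|]. Qed.

End Chebyshev.

Lemma cheb2 k : cheb 2 k = INR k.
Proof.
suff : cheb 2 k = INR k /\ cheb 2 (S k) = INR (S k) by case.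
elim: k => [|k [IH1 IH2]]; first by [].
by split=> //; rewrite chebSS IH1 IH2 !S_INR; lra.
Qed.

Lemma cheb_sin theta k : (cheb (2 * cos theta) k * sin theta = sin (INR k * theta))%R.
Proof.
suff : (cheb (2 * cos theta) k * sin theta = sin (INR k * theta) /\
  cheb (2 * cos theta) (S k) * sin theta = sin (INR (S k) * theta))%R by case.
elim: k => [|k [IH1 IH2]]; first by rewrite /= !Rmult_0_l sin_0 !Rmult_1_l; split; ring.
split=> //; rewrite chebSS Rmult_minus_distr_r Rmult_assoc IH2 IH1.
have -> : (INR (S (S k)) * theta = INR (S k) * theta + theta)%R by rewrite !S_INR; ring.
have -> : (INR k * theta = INR (S k) * theta - theta)%R by rewrite !S_INR; ring.
by rewrite sin_plus sin_minus; ring.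
Qed.

Arguments cheb : simpl never.
Arguments cheb_pred : simpl never.

Section ChebyshevAngle.
Context (m : nat) (m2 : 2 <= m).
Let theta : R := (PI / INR m)%R.

Lemma angle_bounds : (0 < theta <= PI / 2)%R.
Proof.
have M : (2 <= INR m)%R by rewrite -[2%R]/(INR 2); exact: le_INR.
have := PI_RGT_0 => P; split; first by apply: Rdiv_lt_0_compat; lra.
rewrite /theta /Rdiv; apply: Rmult_le_compat_l; first by lra.
by apply: Rinv_le_contravar; lra.
Qed.

Lemma angle_mul : (INR m * theta = PI)%R.
Proof. by rewrite /theta; field; apply: not_0_INR; lia. Qed.

Lemma sin_angle_gt0 : (0 < sin theta)%R.
Proof.
by have [H1 H2] := angle_bounds; apply: sin_gt_0; have := PI_RGT_0; lra.
Qed.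

Lemma cheb_gt0 k : 0 < k < m -> (0 < cheb (2 * cos theta) k)%R.
Proof.
move=> km; have S0 := sin_angle_gt0; have [t0 _] := angle_bounds.
have : (0 < cheb (2 * cos theta) k * sin theta)%R.
  rewrite cheb_sin; apply: sin_gt_0.
    by apply: Rmult_lt_0_compat => //; apply: lt_0_INR; lia.
  by rewrite -angle_mul; apply: Rmult_lt_compat_r => //; apply: lt_INR; lia.
by move=> H; nra.
Qed.

Lemma cheb_m : cheb (2 * cos theta) m = 0%R.
Proof.
have S0 := sin_angle_gt0; have := cheb_sin theta m.
by rewrite angle_mul sin_PI => H; nra.
Qed.

Lemma cheb_pred_m : cheb_pred (2 * cos theta) m = 1%R.
Proof.
have S0 := sin_angle_gt0; have m0 : m = S (m - 1) by lia.
rewrite m0 /cheb_pred; have := cheb_sin theta (m - 1).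
have -> : (INR (m - 1) * theta = PI - theta)%R.
  by rewrite -angle_mul minus_INR; [rewrite /=; ring | lia].
by rewrite sin_minus sin_PI cos_PI => H; nra.
Qed.

Lemma kappa_bounds : (0 <= 2 * cos theta < 2)%R.
Proof.
have [H1 H2] := angle_bounds; have S0 := sin_angle_gt0; have P := PI_RGT_0.
have C0 : (0 <= cos theta)%R by apply: cos_ge_0; lra.
by have := sin2_cos2 theta; rewrite /Rsqr; nra.
Qed.

End ChebyshevAngle.

(** * Alternating words, firing moves and braid relations *)

Fixpoint alt {W : Group} (x y : W) (k : nat) : list W :=
  if k is S k' then x :: alt y x k' else [].

Fixpoint alt_next {W : Group} (x y : W) (k : nat) : W :=
  if k is S k' then alt_next y x k' else x.

Section Game.
Context {W : Group}.
Implicit Types (g s t r u v w x y a b : W) (e l : list W).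

Lemma length_alt x y k : length (alt x y k) = k.
Proof. by elim: k x y => //= k IH x y; rewrite IH. Qed.

Lemma altSr x y k : alt x y (S k) = alt x y k ++ [alt_next x y k].
Proof. by elim: k x y => //= k IH x y; rewrite -IH. Qed.

Lemma alt_cat x y i j :
  alt x y (i + j) = alt x y i ++ alt (alt_next x y i) (alt_next y x i) j.
Proof. by elim: i x y => //= i IH x y; rewrite IH. Qed.

Lemma alt_next_cases x y k :
  alt_next x y k = x /\ alt_next y x k = y \/ alt_next x y k = y /\ alt_next y x k = x.
Proof. by elim: k x y => [|k IH] x y /=; [left | case: (IH x y) => -[-> ->]; auto]. Qed.

Definition braids x y k : Prop := 0 < k /\ gprod (alt x y k) = gprod (alt y x k).

(* [mm x y] is the order of [x * y], with [0] in place of infinity. *)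
Definition mm x y : nat :=
  epsilon (inhabits 0) (fun m =>
    braids x y m /\ (forall k, braids x y k -> m <= k)
    \/ m = 0 /\ forall k, ~ braids x y k).

Lemma mmP x y :
  braids x y (mm x y) /\ (forall k, braids x y k -> mm x y <= k)
  \/ mm x y = 0 /\ forall k, ~ braids x y k.
Proof.
apply: (epsilon_spec (inhabits 0) (fun m => braids x y m /\ (forall k, braids x y k -> m <= k)
    \/ m = 0 /\ forall k, ~ braids x y k)).
have [[k Bk]|N] := classic (exists k, braids x y k); last first.
  by exists 0; right; split=> // k Bk; apply: N; exists k.
elim/(well_founded_ind lt_wf): k Bk => k IH Bk.
have [[j [jk Bj]]|N] := classic (exists j, j < k /\ braids x y j); first exact: IH Bj.
exists k; left; split=> // j Bj; apply: NNPP => H; apply: N; exists j; split=> //; lia.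
Qed.

Lemma mmC x y : mm x y = mm y x.
Proof.
have BC a b k : braids a b k -> braids b a k by move=> [k0 E]; split.
case: (mmP x y) (mmP y x) => [[B1 H1]|[-> N1]] [[B2 H2]|[-> N2]] //.
- by apply: Nat.le_antisymm; [apply/H1/BC | apply/H2/BC].
- by case: (N2 _ (BC _ _ _ B1)).
- by case: (N1 _ (BC _ _ _ B2)).
Qed.

(** For distinct [x], [y], minus twice the canonical bilinear form on the two simple roots; 2 is the
    limit of [2 * cos (PI / m)]. *)
Definition kappa x y : R :=
  if mm x y is 0 then 2%R else (2 * cos (PI / INR (mm x y)))%R.

Lemma kappaC x y : kappa x y = kappa y x.
Proof. by rewrite /kappa mmC. Qed.

(* Coordinates [(true, r)] carry the numbers of Mozes' numbers game, [(false, r)] the total amount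
   fired at [r]; the latter make the simple coroots linearly independent. *)
Definition state : Type := bool * W -> R.

Definition coef (i : bool * W) s : R :=
  let (c, r) := i in
  match excluded_middle_informative (r = s) with
  | left _ => if c then 2%R else (-1)%R
  | right _ => if c then (- kappa r s)%R else 0%R
  end.

Definition fire (p : state) s : state := fun i => (p i - coef i s * p (true, s))%R.

Definition run (p : state) l : state := fold_left fire l p.

Lemma coef_self c s : coef (c, s) s = if c then 2%R else (-1)%R.
Proof. by rewrite /coef; case: excluded_middle_informative. Qed.

Lemma coef_neq c r s : r <> s -> coef (c, r) s = if c then (- kappa r s)%R else 0%R.
Proof. by rewrite /coef; case: excluded_middle_informative. Qed.

Lemma fireK p s : fire (fire p s) s = p.
Proof.
apply: functional_extensionality => i.
by rewrite /fire coef_self; ring.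
Qed.

Lemma run_cat p l1 l2 : run p (l1 ++ l2) = run (run p l1) l2.
Proof. exact: fold_left_app. Qed.

Lemma run_alt p x y k : x <> y ->
  run p (alt x y k) (true, alt_next x y k) =
    (cheb (kappa x y) (S k) * p (true, x) + cheb (kappa x y) k * p (true, y))%R /\
  run p (alt x y k) (true, alt_next y x k) =
    (- (cheb (kappa x y) k * p (true, x) + cheb_pred (kappa x y) k * p (true, y)))%R.
Proof.
elim: k p x y => [|k IH] p x y ne.
  by rewrite /= /cheb /cheb_pred; split; ring.
have ne' : y <> x by move=> E; apply: ne.
have /= [-> ->] := IH (fire p x) y x ne'.
rewrite (kappaC y x) /fire coef_self coef_neq // (kappaC y x) chebSS.
split; first by ring.
by rewrite cheb_predE; change (cheb_pred (kappa x y) (S k)) with (cheb (kappa x y) k); ring.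
Qed.

Lemma run_dihedral p x y k : exists X Y, forall i,
  run p (alt x y k) i = (p i - coef i x * X - coef i y * Y)%R.
Proof.
elim: k p x y => [|k IH] p x y; first by exists 0%R, 0%R => i /=; ring.
have [X [Y H]] := IH (fire p x) y x.
by exists (p (true, x) + Y)%R, X => i; rewrite /= H /fire; ring.
Qed.

Lemma mm_ge2 x y : x <> y -> 0 < mm x y -> 2 <= mm x y.
Proof.
move=> ne m0; case: (mmP x y) => [[[_ E] _]|[E _]]; last by lia.
have [E1|//] : mm x y = 1%nat \/ 2 <= mm x y by lia.
by move: E; rewrite E1 /= !gmulr1 => /ne.
Qed.

(** The Chebyshev values at the order give equal numbers at [x] and [y]. These determine the rest of
    the state, since by [run_dihedral] a run only subtracts multiples of the columns of [x] and
    [y]. *)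
Lemma run_braid p x y : x <> y -> 0 < mm x y ->
  run p (alt x y (mm x y)) = run p (alt y x (mm x y)).
Proof.
move=> ne m0; have m2 := mm_ge2 x y ne m0.
have ne' : y <> x by move=> E; apply: ne.
have Ek : kappa x y = (2 * cos (PI / INR (mm x y)))%R.
  by rewrite /kappa; case: (mm x y) m0 => //; lia.
have Ek' : kappa y x = (2 * cos (PI / INR (mm x y)))%R by rewrite kappaC.
have C0 := cheb_m _ m2; have C1 := cheb_pred_m _ m2; have KB := kappa_bounds _ m2.
have [E1 E2] := run_alt p x y (mm x y) ne.
have [E3 E4] := run_alt p y x (mm x y) ne'.
rewrite cheb_predE Ek C0 C1 in E1 E2; rewrite cheb_predE Ek' C0 C1 in E3 E4.
have [X [Y H]] := run_dihedral p x y (mm x y).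
have [Y' [X' H']] := run_dihedral p y x (mm x y).
have [Ex Ey] : run p (alt x y (mm x y)) (true, x) = run p (alt y x (mm x y)) (true, x) /\
    run p (alt x y (mm x y)) (true, y) = run p (alt y x (mm x y)) (true, y).
  move: E1 E2 E3 E4; case: (alt_next_cases x y (mm x y)) => -[-> ->] -> -> -> ->; split; ring.
rewrite !H !H' !coef_self !coef_neq // kappaC (kappaC y x) in Ex Ey.
(* The differences lie in the kernel of the Cartan matrix of [x], [y], whose eigenvalues
   [2 - kappa x y] and [2 + kappa x y] are positive at finite order. *)
have [E E'] : X = X' /\ Y = Y'.
  rewrite -Ek in KB.
  have /Rmult_integral [|] : ((2 - kappa x y) * ((X - X') + (Y - Y')) = 0)%R; [lra | lra |].
  have /Rmult_integral [|] : ((2 + kappa x y) * ((X - X') - (Y - Y')) = 0)%R; [lra | lra |].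
  by split; lra.
by apply: functional_extensionality => i; rewrite H H' E E'; ring.
Qed.
End Game.

(** * The game as an action of the Coxeter group, and positivity *)

Section Realization.
Context {W : Group} {Sg : W -> Prop} {len : W -> nat} (CL : coxeter_length Sg len).
Implicit Types (g s t r u v w x y a b : W) (e l z : list W).

Definition reduced l : Prop := Forall Sg l /\ length l = len (gprod l).

Definition in2 x y r : Prop := r = x \/ r = y.

(** Minimality is among words in [x] and [y] only; that such words are reduced in [W] is the case
    [v = 1] of [coset_min_len]. *)
Definition dmin x y e : Prop :=
  Forall (in2 x y) e /\
  forall e', Forall (in2 x y) e' -> gprod e' = gprod e -> length e <= length e'.

Definition coset_min x y v : Prop :=
  forall e, Forall (in2 x y) e -> len v <= len (v * gprod e).

Lemma reduced_ex w : exists2 l, reduced l & gprod l = w.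
Proof. by have [l [Fl [<- El]]] := reduced_word CL w; exists l. Qed.

Lemma eps_reduced_rcons l s : reduced (l ++ [s]) ->
  reduced l /\ Sg s /\ eps (len := len) (gprod l) s = 1%Z.
Proof.
move=> [/Forall_app [Fl /Forall_cons_iff [Ss _]]].
rewrite length_app gprod_app /= gmulr1 => E.
have H := len_gprod CL l Fl; have H' := cl_step _ _ CL (gprod l) s Ss.
by split; [split=> //; lia | split=> //; rewrite /eps; lia].
Qed.

Lemma reduced_rcons l s : reduced l -> Sg s -> eps (len := len) (gprod l) s = 1%Z ->
  reduced (l ++ [s]).
Proof.
move=> [Fl El] Ss E; split; first by apply/Forall_app; split=> //; constructor.
by rewrite length_app gprod_app /= gmulr1; move: E; rewrite /eps; lia.
Qed.

Section Dihedral.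
Context {x y : W} (Sx : Sg x) (Sy : Sg y).

Lemma in2_gen r : in2 x y r -> Sg r.
Proof. by case=> ->. Qed.

Lemma in2_Forall e : Forall (in2 x y) e -> Forall Sg e.
Proof. by apply: Forall_impl => r; exact: in2_gen. Qed.

Lemma dmin_ex e : Forall (in2 x y) e -> exists2 e', dmin x y e' & gprod e' = gprod e.
Proof.
move En: (length e) => n; elim/(well_founded_ind lt_wf): n e En => n IH e En Fe.
have [[e' [Fe' [E' lt]]]|N] := classic (exists e', Forall (in2 x y) e' /\
    gprod e' = gprod e /\ length e' < length e).
  have [|e'' D E''] := IH (length e') _ e' (eq_refl _) Fe'; first by lia.
  by exists e'' => //; rewrite E''.
exists e => //; split=> // e' Fe' E'; apply: NNPP => H; apply: N.
by exists e'; split; [|split=> //; lia].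
Qed.

Lemma dmin_init e r : dmin x y (e ++ [r]) -> dmin x y e.
Proof.
move=> [/Forall_app [Fe Fr] M]; split=> // e' Fe' E'.
have := M (e' ++ [r]); rewrite !gprod_app E' !length_app /= => H.
suff : length e + 1 <= length e' + 1 by lia.
by apply: H => //; apply/Forall_app.
Qed.

Lemma dmin_tail e r : dmin x y (r :: e) -> dmin x y e.
Proof.
move=> [/Forall_cons_iff [Fr Fe] M]; split=> // e' Fe' E'.
have := M (r :: e'); rewrite /= E' => H.
suff : S (length e) <= S (length e') by lia.
by apply: H => //; constructor.
Qed.

Lemma gprod_rev l : Forall Sg l -> gprod (rev l) = (gprod l)^-1.
Proof.
elim=> {l} [|r l Sr _ IH] /=; first by grp.
by rewrite gprod_app IH /= ginvM gmulr1 (gen_inv CL r Sr).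
Qed.

(** If appending [r] lowered the length, exchange would delete a letter: one of [e], against the
    minimality of [e ++ [r]], or one of the word of [v], giving a shorter element of its coset. *)
Lemma coset_min_len v e : coset_min x y v -> dmin x y e ->
  len (v * gprod e) = len v + length e.
Proof.
move=> cm; elim/rev_ind: e => [|r e IH] D; first by rewrite /= gmulr1; lia.
have De := dmin_init _ _ D; have [Fe _] := De.
have [/Forall_app [_ /Forall_cons_iff [Fr _]] M] := D; have Sr := in2_gen _ Fr.
rewrite gprod_app length_app /= gmulr1 gmulA.
have L := IH De; have [l [Fl El] Ev] := reduced_ex v.
case: (eps_sign CL (v * gprod e) r Sr) => E; first by move: E; rewrite /eps; lia.
exfalso; have Fle : Forall Sg (l ++ e) by apply/Forall_app; split=> //; exact: in2_Forall.
have [|l1 [c [l2 [Es Ep]]]] := exchange CL (l ++ e) r Fle Sr.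
  by rewrite gprod_app Ev.
have Frev : Forall (in2 x y) ((e ++ [r]) ++ rev e).
  by apply/Forall_app; split; [exact: (proj1 D) | apply: Forall_rev].
have del_e k c' k' : e = k ++ c' :: k' -> gprod (l ++ e) * r = gprod ((l ++ k) ++ k') -> False.
  move=> Ee; rewrite -app_assoc !gprod_app -gmulA => /gmul_injl Ek.
  have := M (k ++ k'); rewrite !gprod_app /= gmulr1 -Ek Ee !length_app /= => H.
  suff : length k + S (length k') + 1 <= length k + length k' by lia.
  by apply: H => //; move: Fe; rewrite Ee !Forall_app Forall_cons_iff => -[? []].
have [k [[E1 E2]|[E1 E2]]] := app_eq_app _ _ _ _ (eq_sym Es).
  by apply: (del_e k c l2); rewrite -?E1.
case: k E1 E2 => [|c' k] /= E1 E2.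
  by apply: (del_e [] c l2) => //; rewrite app_nil_r Ep E1 app_nil_r.
have := cm _ Frev; rewrite !gprod_app (gprod_rev e) ?gmulA /=; last exact: in2_Forall.
rewrite gmulr1 -Ev -gprod_app Ep -El E1.
case: E2 => Ec ->; rewrite app_assoc gprod_app -gmulA gmulVr gmulr1 length_app /=.
move=> H; have Flk : Forall Sg (l1 ++ k).
  by move: Fl; rewrite E1 !Forall_app Forall_cons_iff => -[? []].
by have := len_gprod CL _ Flk; rewrite length_app; lia.
Qed.

Lemma dmin_alt e : dmin x y e ->
  exists a b, (a = x /\ b = y \/ a = y /\ b = x) /\ e = alt a b (length e).
Proof.
elim: e => [|r e IH] D; first by exists x, y; split=> //; left.
have [a [b [ab Ee]]] := IH (dmin_tail _ _ D).
have [/Forall_cons_iff [Fr Fe] M] := D.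
have [rb|ra] : r = b \/ r = a by move: Fr ab; rewrite /in2; intuition congruence.
  by exists b, a; split; [intuition | rewrite /= -Ee rb].
case: e Ee IH D Fe M => [|c e] /= Ee IH D Fe M.
  by exists a, b; rewrite ra.
case: Ee => Ec _; exfalso.
have Fe' : Forall (in2 x y) e by move: Fe; rewrite Forall_cons_iff; case.
have Sa : Sg a by rewrite -ra; exact: in2_gen.
by move: (M e Fe'); rewrite ra Ec (genK CL) // => /(_ (eq_refl _)); lia.
Qed.

(** In a longer word, turning the [mm a b] letters after the first by the braid relation puts two
    equal letters side by side. *)
Lemma dmin_le_mm a b k : (a = x /\ b = y \/ a = y /\ b = x) ->
  dmin x y (alt a b k) -> 0 < mm a b -> k <= mm a b.
Proof.
move=> ab [F M] m0; apply: NNPP => H.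
case: (mmP a b) => [[[_ Em] _]|[E _]]; last by lia.
set m := mm a b in m0 H Em.
have Ek : k = S (m + (k - S m)) by lia.
have Sa : Sg a by case: ab => -[-> _].
have m1 : m = S (m - 1) by lia.
pose rest := alt (alt_next b a m) (alt_next a b m) (k - S m).
have Fab i c d : (c = x /\ d = y \/ c = y /\ d = x) -> Forall (in2 x y) (alt c d i).
  elim: i c d => [|i IH] c d H' /=; first by constructor.
  by constructor; [case: H' => -[-> _]; [left | right] | apply: IH; tauto].
have := M (alt b a (m - 1) ++ rest); rewrite length_app /rest !length_alt => H'.
suff : k <= m - 1 + (k - S m) by lia.
apply: H'.
  apply/Forall_app; split; apply: Fab; first by tauto.
  by case: (alt_next_cases a b m) => -[-> ->]; tauto.
have Eh : gprod (alt b a (m - 1)) = a * gprod (alt a b m).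
  by rewrite m1 /= Nat.sub_0_r (genK CL).
by rewrite {2}Ek /= alt_cat !gprod_app -Em Eh gmulA.
Qed.

Lemma dihedral_factor w : exists v e,
  coset_min x y v /\ dmin x y e /\ w = v * gprod e /\ len w = len v + length e.
Proof.
pose Q n := exists e, Forall (in2 x y) e /\ len (w * gprod e) = n.
have [n [[e [Fe En]] M]] : exists n, Q n /\ forall k, Q k -> n <= k.
  have : Q (len w) by exists []; split; [constructor | rewrite /= gmulr1].
  elim/(well_founded_ind lt_wf): (len w) => n IH Qn.
  have [[k [kn Qk]]|N] := classic (exists k, k < n /\ Q k); first exact: IH Qk.
  exists n; split=> // k Qk; apply: NNPP => H; apply: N; exists k; split=> //; lia.
have cm : coset_min x y (w * gprod e).
  move=> e' Fe'; rewrite En -gmulA -gprod_app; apply: M.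
  by exists (e ++ e'); split=> //; apply/Forall_app.
have [e' D Ee'] := dmin_ex _ (Forall_rev Fe).
exists (w * gprod e), e'; split=> //; split=> //.
have Ew : w = w * gprod e * gprod e'.
  by rewrite Ee' gprod_rev; [grp | exact: in2_Forall].
by split=> //; rewrite {1}Ew; exact: coset_min_len.
Qed.

Lemma dihedral_descent v e r : coset_min x y v -> dmin x y e -> in2 x y r ->
  eps (len := len) (v * gprod e) r = (-1)%Z ->
  exists e', dmin x y (e' ++ [r]) /\ gprod (e' ++ [r]) = gprod e /\ length e = S (length e').
Proof.
move=> cm D Fr E; have Sr := in2_gen _ Fr; have [Fe M] := D.
have [|e' D' Ee'] := dmin_ex (e ++ [r]).
  by apply/Forall_app; split=> //; constructor.
have Ep : gprod (e' ++ [r]) = gprod e.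
  by rewrite gprod_app Ee' gprod_app /= !gmulr1 (genKr CL).
have L : length e = S (length e').
  move: E; rewrite /eps -gmulA (coset_min_len _ _ cm D).
  have -> : gprod e * r = gprod e' by rewrite Ee' gprod_app /= gmulr1.
  by rewrite (coset_min_len _ _ cm D'); lia.
exists e'; split=> //; split.
  by apply/Forall_app; split; [case: D' | constructor].
by move=> e2 F2; rewrite Ep length_app /= => /(M _ F2); lia.
Qed.

End Dihedral.

Lemma reduced_cat v l e : reduced l -> gprod l = v -> Forall Sg e ->
  len (v * gprod e) = len v + length e -> reduced (l ++ e).
Proof.
move=> [Fl El] <- Fe E; split; first by apply/Forall_app.
by rewrite length_app gprod_app E -El.
Qed.

Lemma dmin_Forall x y e : Sg x -> Sg y -> dmin x y e -> Forall Sg e.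
Proof. by move=> Sx Sy [Fe _]; apply: Forall_impl Fe => r [->|->]. Qed.

(** Matsumoto's theorem for firings. When the last letters [s] and [t] differ, the dihedral part of
    the product has minimal words ending in [s] and in [t]; these are the two sides of the braid
    relation, and the prefixes are handled by induction. *)
Lemma run_reduced p l l' : reduced l -> reduced l' -> gprod l = gprod l' ->
  run p l = run p l'.
Proof.
move En: (length l) => n; elim: n l l' En => [|n IH] l l' En R R' E.
  have En' : length l' = 0 by rewrite (proj2 R') -E -(proj2 R).
  by case: l' {R' E} En' => //; case: l {R} En.
have En' : length l' = S n by rewrite (proj2 R') -E -(proj2 R).
elim/rev_ind: l En R E => [//|s z _]; rewrite length_app /= => En R E.
elim/rev_ind: l' En' R' E => [//|t z' _]; rewrite length_app /= => En' R' E.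
have [Rz [Ss es]] := eps_reduced_rcons _ _ R.
have [Rz' [St et]] := eps_reduced_rcons _ _ R'.
have Es : gprod z * s = gprod z' * t by move: E; rewrite !gprod_app /= !gmulr1.
rewrite !run_cat; have [st|st] := classic (s = t).
  have -> : run p z = run p z'; last by rewrite st.
  apply: IH => //; [lia | apply: (gmul_injr s); rewrite Es st //].
set w := gprod z * s in Es.
have [v [e [cm [D [Ew Lw]]]]] := dihedral_factor Ss St w.
have [lv Rv Ev] := reduced_ex v.
have ds : eps (len := len) (v * gprod e) s = (-1)%Z.
  by rewrite -Ew /w (eps_flip CL) // es.
have dt : eps (len := len) (v * gprod e) t = (-1)%Z.
  by rewrite -Ew Es (eps_flip CL) // et.
have [e1 [D1 [E1 L1]]] := dihedral_descent Ss St v e s cm D (or_introl eq_refl) ds.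
have [e2 [D2 [E2 L2]]] := dihedral_descent Ss St v e t cm D (or_intror eq_refl) dt.
have repl q r e' : reduced (q ++ [r]) -> length q = n -> gprod q * r = w ->
    dmin s t (e' ++ [r]) -> gprod (e' ++ [r]) = gprod e ->
    run (run p q) [r] = run (run p lv) (e' ++ [r]).
  move=> Rq Lq Eq Dr Er; have [Rq' [Sr _]] := eps_reduced_rcons _ _ Rq.
  have D' := dmin_init _ _ Dr.
  have -> : run p q = run p (lv ++ e'); last by rewrite !run_cat.
  apply: IH => //.
    apply: (reduced_cat v) => //; first exact: dmin_Forall D'.
    exact: (coset_min_len Ss St).
  apply: (gmul_injr r); rewrite Eq Ew -Er !gprod_app Ev /= gmulr1; grp.
rewrite (repl z s e1) ?(repl z' t e2) //; try lia.
have [a [b [ab Ea]]] := dmin_alt Ss St _ D1.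
have [a' [b' [ab' Ea']]] := dmin_alt Ss St _ D2.
move: Ea Ea'; rewrite !length_app /= !Nat.add_1_r -L1 -L2 => Ea Ea'.
have aa' : a' = b /\ b' = a.
  have [aa|?] := classic (a' = a); last by intuition congruence.
  exfalso; apply: st; have bb : b' = b by intuition congruence.
  rewrite aa bb -Ea in Ea'.
  by have [_ ->] := app_inj_tail _ _ _ _ Ea'.
case: aa' => ? ?; subst a' b'; rewrite Ea Ea'.
have Bk : braids a b (length e) by split; [lia | rewrite -Ea -Ea' E1 E2].
have Em : length e = mm a b.
  case: (mmP a b) => [[[m0 _] Mm]|[_ N]]; last by case: (N _ Bk).
  apply: Nat.le_antisymm; last exact: Mm.
  by apply: (dmin_le_mm Ss St) => //; rewrite -Ea.
by rewrite Em; apply: run_braid; [intuition congruence | rewrite -Em; lia].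
Qed.

(** Positivity of roots in terms of the game. The number at [s] combines the two numbers left after
    the coset representative [v], positive by induction; the coefficients are [cheb] at indices at
    most the order, because the dihedral part followed by [s] is still minimal. *)
Lemma run_ascent_gt0 p : (forall r, Sg r -> 0 < p (true, r))%R ->
  forall l s, reduced l -> Sg s -> eps (len := len) (gprod l) s = 1%Z ->
  (0 < run p l (true, s))%R.
Proof.
move=> p0 l; move En: (length l) => n.
elim/(well_founded_ind lt_wf): n l En => n IH l En s R Ss es.
elim/rev_ind: l En R es => [|t z _] En R es; first exact: p0.
have [Rz [St et]] := eps_reduced_rcons _ _ R.
have Eg : gprod (z ++ [t]) = gprod z * t by rewrite gprod_app /= gmulr1.
have [v [e [cm [D [Ew Lw]]]]] := dihedral_factor Ss St (gprod (z ++ [t])).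
have dt : eps (len := len) (v * gprod e) t = (-1)%Z.
  by rewrite -Ew Eg (eps_flip CL) // et.
have [e1 [D1 [E1 L1]]] := dihedral_descent Ss St v e t cm D (or_intror eq_refl) dt.
have [lv Rv Ev] := reduced_ex v.
have R1 : reduced (lv ++ (e1 ++ [t])).
  apply: (reduced_cat v) => //; first exact: dmin_Forall D1.
  exact: (coset_min_len Ss St).
have Eg1 : gprod (z ++ [t]) = gprod (lv ++ (e1 ++ [t])) by rewrite (gprod_app lv) Ev E1.
rewrite (run_reduced p _ _ R R1 Eg1) run_cat.
have [a [b [ab Ea]]] := dmin_alt Ss St _ D1.
have D2 : dmin s t ((e1 ++ [t]) ++ [s]).
  split; first by apply/Forall_app; split; [case: D1 | constructor; [left | constructor]].
  move=> e' Fe' Ee'; have Fe'' : Forall Sg e' by apply: Forall_impl Fe' => r [->|->].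
  have H := len_gprod CL e' Fe''.
  have H' := len_mul CL v (gprod e').
  move: es; rewrite /eps Lw Ew length_app.
  rewrite -E1 -gmulA.
  have -> : gprod (e1 ++ [t]) * s = gprod e' by rewrite Ee' (gprod_app _ [s]) /= gmulr1.
  by rewrite length_app /=; lia.
have ne : a <> b.
  move=> Eab; have st : s = t by intuition congruence.
  by move: es; rewrite Ew st dt.
move: Ea; rewrite length_app /= Nat.add_1_r => Ea.
have [_ Et] : e1 = alt a b (length e1) /\ t = alt_next a b (length e1).
  by move: (Ea); rewrite altSr => Ea'; exact: app_inj_tail Ea'.
have Es : alt_next a b (S (length e1)) = s.
  by rewrite /=; case: (alt_next_cases a b (length e1)) Et => -[-> ->] Et; intuition congruence.
have E2 : (e1 ++ [t]) ++ [s] = alt a b (S (S (length e1))) by rewrite altSr Es -Ea.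
rewrite Ea -Es; have [-> _] := run_alt (run p lv) a b (S (length e1)) ne.
have Llv : length lv < n by move: (proj2 Rv) (proj2 R); rewrite Ev Lw -En; lia.
have pos r : in2 s t r -> (0 < run p lv (true, r))%R.
  move=> Fr; have Sr := in2_gen Ss St _ Fr.
  apply: (IH _ Llv _ (eq_refl _)) => //.
  have := cm [r]; rewrite Ev /= gmulr1 => /(_ (Forall_cons _ Fr (Forall_nil _))).
  by case: (eps_sign CL v r Sr) => //; rewrite /eps; lia.
have pa : (0 < run p lv (true, a))%R by apply: pos; rewrite /in2; tauto.
have pb : (0 < run p lv (true, b))%R by apply: pos; rewrite /in2; tauto.
suff [c1 c2] : (0 < cheb (kappa a b) (S (length e1)) /\
    0 <= cheb (kappa a b) (S (S (length e1))))%R by nra.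
have [m0|m0] := Nat.eq_dec (mm a b) 0.
  have -> : kappa a b = 2%R by rewrite /kappa m0.
  by rewrite !cheb2; split; [apply: lt_0_INR; lia | exact: pos_INR].
have le : S (S (length e1)) <= mm a b.
  by apply: (dmin_le_mm Ss St) => //; [rewrite -E2 | lia].
have -> : kappa a b = (2 * cos (PI / INR (mm a b)))%R.
  by rewrite /kappa; case: (mm a b) m0.
have m2 : 2 <= mm a b by lia.
split; first by apply: cheb_gt0; lia.
have [->|lt] : S (S (length e1)) = mm a b \/ S (S (length e1)) < mm a b by lia.
  by rewrite cheb_m //; lra.
by apply/Rlt_le/cheb_gt0; lia.
Qed.

Lemma game_exists : exists P : W -> state,
  (forall w s, Sg s -> P (w * s) = fire (P w) s) /\
  (forall w s, Sg s -> (P w (true, s) <= 0)%R -> eps (len := len) w s = (-1)%Z).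
Proof.
(* A point inside the fundamental chamber, with nothing fired yet. *)
pose p0 : state := fun i : bool * W => if fst i then 1%R else 0%R.
have ex w : exists p, forall l, reduced l -> gprod l = w -> run p0 l = p.
  have [l R E] := reduced_ex w; exists (run p0 l) => l' R' E'.
  by apply: run_reduced; rewrite // E E'.
pose P w := proj1_sig (constructive_indefinite_description _ (ex w)).
have HP l : reduced l -> P (gprod l) = run p0 l.
  move=> R; rewrite /P; case: constructive_indefinite_description => p /= H.
  by rewrite H.
have up w s : Sg s -> eps (len := len) w s = 1%Z -> P (w * s) = fire (P w) s.
  move=> Ss E; have [l R El] := reduced_ex w; rewrite -El in E.
  have R' := reduced_rcons _ _ R Ss E.
  have -> : w * s = gprod (l ++ [s]) by rewrite gprod_app El /= gmulr1.
  by rewrite -El !HP // run_cat.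
exists P; split=> w s Ss.
  case: (eps_sign CL w s Ss) => E; first exact: up.
  rewrite -{2}(genKr CL s w Ss) (up (w * s) s) //; first by rewrite fireK.
  by rewrite (eps_flip CL) // E.
case: (eps_sign CL w s Ss) => // E; have [l R El] := reduced_ex w.
rewrite -El in E *; rewrite HP // => H.
have : (0 < run p0 l (true, s))%R; last by lra.
by apply: run_ascent_gt0 => // r _; rewrite /p0 /=; lra.
Qed.

(** * Finite order of the Coxeter element bounds the length *)

Section CoxeterElement.
Context {gens : list W} (Hgens : forall s, Sg s <-> In s gens) (Ugens : NoDup gens).

Fixpoint rsum (F : nat -> R) (n : nat) : R :=
  if n is S m then (rsum F m + F m)%R else 0%R.

Lemma rsum_shift F n : (rsum (fun k => F (S k)) n = rsum F n - F 0%nat + F n)%R.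
Proof. by elim: n => [|n IH] /=; [ring | rewrite IH; ring]. Qed.

Lemma rsum_ext F F' n : (forall k, F k = F' k) -> rsum F n = rsum F' n.
Proof. by move=> E; elim: n => //= n ->; rewrite E. Qed.

Lemma rsum_fire F (c : R) F' n :
  rsum (fun k => F k - c * F' k)%R n = (rsum F n - c * rsum F' n)%R.
Proof. by elim: n => [|n IH] /=; [ring | rewrite IH; ring]. Qed.

Lemma rsum_le0 F n : 0 < n -> rsum F n = 0%R -> exists2 k, k < n & (F k <= 0)%R.
Proof.
move=> n0 E; apply: NNPP => N.
have pos k : k < n -> (0 < F k)%R.
  by move=> kn; apply: Rnot_le_lt => H; apply: N; exists k.
have : forall m, m <= n -> (0 <= rsum F m)%R /\ (0 < m -> (0 < rsum F m)%R).
  elim=> [|m IH] mn /=; first by split; [lra | lia].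
  have [H _] := IH (Nat.lt_le_incl _ _ mn); have := pos m mn.
  by split; [|move=> _]; lra.
by move=> /(_ n (le_n n)) [_ /(_ n0)]; lra.
Qed.

Definition coxeter_element : W := gprod gens.

(* Summing the game over the powers of [c], every node is fired once per turn and the totals
   return to their value, so the sum of the numbers at each node vanishes. *)
Lemma coxeter_element_descent h : 0 < h -> coxeter_element ^ h = 1 ->
  forall u s, Sg s ->
  exists2 k, k < h & eps (len := len) (coxeter_element ^ k * u) s = (-1)%Z.
Proof.
move=> h0 Eh u s Ss; have [P [HP Hneg]] := game_exists.
set c := coxeter_element in Eh *.
pose M g : state := fun i => rsum (fun k => P (c ^ k * g) i) h.
have HM g r : Sg r -> M (g * r) = fire (M g) r.
  move=> Sr; apply: functional_extensionality => i; rewrite /M /fire -rsum_fire.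
  by apply: rsum_ext => k; rewrite gmulA HP.
have Mc : M c = M 1.
  apply: functional_extensionality => i; rewrite /M.
  rewrite (rsum_ext _ (fun k => P (c ^ (S k) * 1) i)); last by move=> k; rewrite gpowS gmulr1.
  by rewrite (rsum_shift (fun k => P (c ^ k * 1) i)) Eh /=; ring.
have away l g r : Forall Sg l -> ~ In r l -> M (g * gprod l) (false, r) = M g (false, r).
  elim: l g => [|a l IH] g; first by rewrite /= gmulr1.
  move=> /Forall_cons_iff [Sa Fl] /= N; rewrite gmulA IH; [|by []|by tauto].
  by rewrite HM // /fire coef_neq; [ring | move=> E; apply: N; left].
have fired l1 r l2 : gens = l1 ++ r :: l2 -> M (gprod l1) (true, r) = 0%R.
  move=> E; have Fg : Forall Sg gens by apply/Forall_forall => a /Hgens.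
  have Ug := Ugens; rewrite E in Ug Fg; have N := NoDup_remove_2 _ _ _ Ug.
  move: Fg => /Forall_app [F1 /Forall_cons_iff [Sr F2]].
  rewrite in_app_iff in N.
  have E1 : M (gprod l1) (false, r) = M 1 (false, r).
    by rewrite -(gmul1 _ (gprod l1)); apply: away; tauto.
  have E2 : M c (false, r) = M (gprod l1 * r) (false, r).
    rewrite /c /coxeter_element E gprod_app /= gmulA; apply: away; tauto.
  by move: E2; rewrite Mc HM // /fire coef_self -E1; lra.
have fire0 g r : Sg r -> M g (true, r) = 0%R -> M (g * r) = M g.
  move=> Sr E; rewrite HM //; apply: functional_extensionality => i.
  by rewrite /fire E; ring.
(* Firing a node with number 0 changes nothing, so the summed state is constant throughout the
   turn. *)
have prefix l1 : forall l2, gens = l1 ++ l2 -> M (gprod l1) = M 1.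
  elim/rev_ind: l1 => [//|r l1 IH] l2; rewrite -app_assoc /= => E.
  rewrite gprod_app /= gmulr1 fire0; [exact: IH E | | exact: (fired _ _ _ E)].
  by apply/Hgens; rewrite E; apply: in_elt.
have M1 r : Sg r -> M 1 (true, r) = 0%R.
  move=> /Hgens Ir; have [l1 [l2 E]] := in_split _ _ Ir.
  by rewrite -(prefix l1 _ E); apply: (fired _ _ _ E).
have Mu g : M g = M 1.
  elim/(gen_ind CL): g => [//|g r Sr IH].
  by rewrite fire0 // IH M1.
have [|k kh Hk] := rsum_le0 (fun k => P (c ^ k * u) (true, s)) h h0.
  by rewrite -/(M u (true, s)) Mu M1.
by exists k => //; apply: Hneg.
Qed.

Fixpoint zsum (F : nat -> Z) (n : nat) : Z :=
  if n is S m then (zsum F m + F m)%Z else 0%Z.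

(** A letter raises [T] by at most [h - 2], since at least one of the [h] terms drops, while the
    triangle inequality gives [h * len g <= T g + T 1]. Together [2 * len g <= 2 * T 1]. *)
Lemma finite_order_bounded h : 0 < h -> coxeter_element ^ h = 1 ->
  exists B, forall u, len u <= B.
Proof.
move=> h0 Eh; set c := coxeter_element in Eh *.
pose T g := zsum (fun k => Z.of_nat (len (c ^ k * g))) h.
have step g s : Sg s -> (T (g * s)%grp <= T g + Z.of_nat h - 2)%Z.
  move=> Ss; have [j jh Ej] := coxeter_element_descent h h0 Eh g s Ss.
  suff : forall n, (zsum (fun k => Z.of_nat (len (c ^ k * (g * s))%grp)) n <=
      zsum (fun k => Z.of_nat (len (c ^ k * g)%grp)) n + Z.of_nat n
      - (if Nat.ltb j n then 2 else 0))%Z.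
    by move=> /(_ h); rewrite (proj2 (Nat.ltb_lt _ _) jh) /T; lia.
  elim=> [|n IH]; first by [].
  rewrite Nat2Z.inj_succ /=; have En := eps_sign CL (c ^ n * g) s Ss.
  have [E|ne] := Nat.eq_dec j n.
    move: IH Ej; rewrite E Nat.ltb_irrefl (proj2 (Nat.ltb_lt n (S n)) (le_n _)).
    by rewrite /eps -/c -!gmulA; lia.
  have -> : Nat.ltb j (S n) = Nat.ltb j n.
    by apply/Bool.eq_true_iff_eq; rewrite !Nat.ltb_lt; lia.
  by move: IH En; rewrite /eps -!gmulA; lia.
have low g : (Z.of_nat h * Z.of_nat (len g) <= T g + T 1%grp)%Z.
  rewrite /T; elim: (h) => [|n IH]; first by [].
  rewrite Nat2Z.inj_succ /=.
  have H := len_mul CL ((c ^ n)^-1) (c ^ n * g).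
  by move: IH H; rewrite gmulKl (cl_inv _ _ CL) gmulr1; lia.
have high g : (T g <= T 1%grp + Z.of_nat (len g) * (Z.of_nat h - 2))%Z.
  have [l [Fl El] <-] := reduced_ex g; rewrite -El.
  elim/rev_ind: l Fl {El} => [|s l IH]; first by move=> _ /=; lia.
  move=> /Forall_app [Fl /Forall_cons_iff [Ss _]].
  rewrite gprod_app length_app /= gmulr1.
  by move: (IH Fl) (step (gprod l) s Ss); lia.
exists (Z.to_nat (T 1%grp)) => u; move: (low u) (high u); lia.
Qed.

End CoxeterElement.
End Realization.

(** * BN-pairs *)

Section Quotient.
Context {G : Group} (N T : G -> Prop) (subN : is_subgroup N) (subT : is_subgroup T).
Context (TN : forall x, T x -> N x) (normT : forall n t, N n -> T t -> T (n * t * n^-1)).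

(** A canonical representative of [x T]: equal cosets have extensionally equal predicates, for which
    [epsilon] makes the same choice. The quotient can then consist of representatives, with plain
    equality. *)
Let rep (x : G) : G := epsilon (inhabits 1) (fun y => T (x^-1 * y)).

Lemma rep_spec x : T (x^-1 * rep x).
Proof.
apply: (epsilon_spec (inhabits 1) (fun y => T (x^-1 * y))).
by exists x; rewrite gmulV; case: subT.
Qed.

Lemma rep_eq x y : T (x^-1 * y) -> rep x = rep y.
Proof.
case: subT => [T1 [TM TV]] H; rewrite /rep; congr epsilon.
apply: functional_extensionality => z; apply: propositional_extensionality; split=> Hz.
  have -> : y^-1 * z = (x^-1 * y)^-1 * (x^-1 * z) by grp.
  by apply: TM => //; apply: TV.
have -> : x^-1 * z = (x^-1 * y) * (y^-1 * z) by grp.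
exact: TM.
Qed.

Let Q : Type := {x : G | N x /\ rep x = x}.

Lemma quotient_eq (a b : Q) : proj1_sig a = proj1_sig b -> a = b.
Proof.
by case: a b => [a Ha] [b Hb] /= E; subst b; congr exist; exact: proof_irrelevance.
Qed.

Let cl_spec x : N x -> N (rep x) /\ rep (rep x) = rep x.
Proof.
case: subN => [N1 [NM NV]] Nx; split; last by symmetry; apply/rep_eq/rep_spec.
by rewrite -(gmulKVl x (rep x)); apply: NM => //; apply/TN/rep_spec.
Qed.

Let cl (x : G) (Nx : N x) : Q := exist _ (rep x) (cl_spec x Nx).

Let valN (a : Q) : N (proj1_sig a) := proj1 (proj2_sig a).

Let mulN x y : N x -> N y -> N (x * y) := proj1 (proj2 subN) x y.
Let invN x : N x -> N x^-1 := proj2 (proj2 subN) x.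
Let oneN : N 1 := proj1 subN.

Lemma rep_mull x y : N x -> N y -> rep (rep x * y) = rep (x * y).
Proof.
move=> Nx Ny; symmetry; apply: rep_eq.
have -> : (x * y)^-1 * (rep x * y) = y^-1 * (x^-1 * rep x) * y^-1^-1 by grp.
by apply: normT; [exact: invN | exact: rep_spec].
Qed.

Lemma rep_mulr x y : rep (x * rep y) = rep (x * y).
Proof.
symmetry; apply: rep_eq.
have -> : (x * y)^-1 * (x * rep y) = y^-1 * rep y by grp.
exact: rep_spec.
Qed.

Lemma rep_val (a : Q) : rep (proj1_sig a) = proj1_sig a.
Proof. exact: proj2 (proj2_sig a). Qed.

Lemma quotient_exists : exists (W : Group) (pi : G -> W),
  (forall x y, N x -> N y -> pi (x * y) = pi x * pi y) /\
  (forall x, N x -> pi x = 1 <-> T x) /\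
  (forall w, exists2 x, N x & pi x = w).
Proof.
pose mul (a b : Q) := cl _ (mulN _ _ (valN a) (valN b)).
pose inv (a : Q) := cl _ (invN _ (valN a)).
pose one : Q := cl _ oneN.
have mulA a b c : mul a (mul b c) = mul (mul a b) c.
  apply: quotient_eq; rewrite /= rep_mulr gmulA.
  by rewrite (rep_mull _ _ (mulN _ _ (valN a) (valN b)) (valN c)).
have mul1 a : mul one a = a.
  by apply: quotient_eq; rewrite /= (rep_mull _ _ oneN (valN a)) gmul1 rep_val.
have mulV a : mul (inv a) a = one.
  by apply: quotient_eq; rewrite /= (rep_mull _ _ (invN _ (valN a)) (valN a)) gmulV.
pose W := Build_Group Q mul inv one mulA mul1 mulV.
(* [one] is a dummy value outside [N]. *)
pose pi (x : G) : W := match excluded_middle_informative (N x) with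
  | left Nx => cl x Nx | right _ => one end.
have piE x : N x -> proj1_sig (pi x : Q) = rep x.
  by move=> Nx; rewrite /pi; case: excluded_middle_informative.
exists W, pi; split; [|split].
- move=> x y Nx Ny; apply: quotient_eq; rewrite piE /=; last exact: mulN.
  by rewrite !piE // rep_mulr rep_mull.
- move=> x Nx; split=> [E|Tx].
    have E' : rep x = rep 1 by rewrite -(piE x Nx) E.
    case: subT => [T1 [TM TV]].
    have Tr : T (rep 1) by have := rep_spec 1; rewrite ginv1 gmul1.
    have Txr := rep_spec x; rewrite E' in Txr.
    have -> : x = rep 1 * (x^-1 * rep 1)^-1 by grp.
    by apply: TM => //; apply: TV.
  apply: quotient_eq; rewrite piE //=; symmetry; apply: rep_eq.
  by rewrite ginv1 gmul1.
- move=> w; exists (proj1_sig (w : Q)); first exact: valN.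
  by apply: quotient_eq; rewrite piE; [exact: rep_val | exact: valN].
Qed.

End Quotient.

Section WordLength.
Context {W : Group} (Sg : W -> Prop) (invol : forall s, Sg s -> s * s = 1).
Context (genW : forall w, exists2 x, Forall Sg x & gprod x = w).
Implicit Types (w s : W) (x : list W).

Definition word_length w : nat := epsilon (inhabits 0) (fun n =>
  (exists x, Forall Sg x /\ gprod x = w /\ length x = n) /\
  forall x, Forall Sg x -> gprod x = w -> n <= length x).

Lemma word_lengthP w :
  (exists x, Forall Sg x /\ gprod x = w /\ length x = word_length w) /\
  forall x, Forall Sg x -> gprod x = w -> word_length w <= length x.
Proof.
apply: (epsilon_spec (inhabits 0) (fun n =>
  (exists x, Forall Sg x /\ gprod x = w /\ length x = n) /\
  forall x, Forall Sg x -> gprod x = w -> n <= length x)).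
have [x Fx Ex] := genW w.
move En: (length x) => n; elim/(well_founded_ind lt_wf): n x Fx Ex En => n IH x Fx Ex En.
have [[y [Fy [Ey lt]]]|M] := classic (exists y, Forall Sg y /\ gprod y = w /\ length y < n).
  exact: (IH _ lt y).
exists n; split; first by exists x.
by move=> y Fy Ey; apply: NNPP => H; apply: M; exists y; split=> //; split=> //; lia.
Qed.

Lemma word_length_le x : Forall Sg x -> word_length (gprod x) <= length x.
Proof. by move=> Fx; apply: (proj2 (word_lengthP _)). Qed.

Lemma word_length_inv_le w : word_length w^-1 <= word_length w.
Proof.
have [[x [Fx [Ex <-]]] _] := word_lengthP w.
rewrite -length_rev; have -> : w^-1 = gprod (rev x).
  rewrite -Ex; elim: Fx => {x Ex} [|s x Ss _ IH] /=; first by rewrite ginv1.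
  by rewrite gprod_app ginvM IH /= gmulr1 (ginv_uniq s s) ?invol.
exact: word_length_le (Forall_rev Fx).
Qed.

Lemma word_length_inv w : word_length w^-1 = word_length w.
Proof.
apply: Nat.le_antisymm; first exact: word_length_inv_le.
by rewrite -{1}(ginvK w); exact: word_length_inv_le.
Qed.

Lemma word_length_mulr_le w s : Sg s -> word_length (w * s) <= S (word_length w).
Proof.
move=> Ss; have [[x [Fx [<- <-]]] _] := word_lengthP w.
have -> : gprod x * s = gprod (x ++ [s]) by rewrite gprod_app /= gmulr1.
rewrite -Nat.add_1_r -[1%nat]/(length [s]) -length_app; apply: word_length_le.
by apply/Forall_app; split=> //; constructor.
Qed.

Lemma word_length_mulr_ge w s : Sg s -> word_length w <= S (word_length (w * s)).
Proof.
move=> Ss; have := word_length_mulr_le (w * s) s Ss.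
by rewrite -gmulA invol // gmulr1.
Qed.

Lemma word_length_mull_le w s : Sg s -> word_length (s * w) <= S (word_length w).
Proof.
move=> Ss; rewrite -word_length_inv -(word_length_inv w) ginvM (ginv_uniq s s) ?invol //.
exact: word_length_mulr_le.
Qed.

Lemma word_length0 w : word_length w = 0 <-> w = 1.
Proof.
split=> [E|->]; last by have := word_length_le [] (Forall_nil _); rewrite /=; lia.
have [[x [_ [Ex Lx]]] _] := word_lengthP w; rewrite E in Lx.
by rewrite -Ex; case: x Lx {Ex}.
Qed.

Lemma word_length_desc w : w <> 1 ->
  exists s, Sg s /\ word_length w = S (word_length (w * s)).
Proof.
move=> w1; have [[x [Fx [Ex Lx]]] _] := word_lengthP w.
elim/rev_ind: x Fx Ex Lx => [|s x _]; first by move=> _ /= E; case: w1.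
move=> /Forall_app [Fx /Forall_cons_iff [Ss _]]; rewrite gprod_app length_app /= gmulr1.
move=> Ew Lw; exists s; split=> //.
have := word_length_le x Fx; have := word_length_mulr_ge w s Ss.
have -> : w * s = gprod x by rewrite -Ew -gmulA invol // gmulr1.
by lia.
Qed.

End WordLength.

(** * Bruhat decomposition and the length function of a BN-pair *)

Section BNPair.
Context {G : Group} {B N : G -> Prop} {S : list G} (BN : is_BN_pair B N S).
Context {W : Group} {pi : G -> W}.
Context (pi_mul : forall x y, N x -> N y -> pi (x * y) = pi x * pi y).
Context (pi_ker : forall x, N x -> pi x = 1 <-> BNT B N x).
Context (pi_surj : forall w, exists2 x, N x & pi x = w).
Implicit Types (g b : G) (w : W).

Definition Sg (w : W) : Prop := In w (map pi S).

Let B1 : B 1. Proof. by case: BN => -[? _] _. Qed.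
Let BM x y : B x -> B y -> B (x * y). Proof. by case: BN => -[_ [H _]] _; exact: H. Qed.
Let BV x : B x -> B x^-1. Proof. by case: BN => -[_ [_ H]] _; exact: H. Qed.
Let N1 : N 1. Proof. by case: BN => _ [[? _] _]. Qed.
Let NM x y : N x -> N y -> N (x * y).
Proof. by case: BN => _ [[_ [H _]] _]; exact: H. Qed.
Let NV x : N x -> N x^-1. Proof. by case: BN => _ [[_ [_ H]] _]; exact: H. Qed.

Let S_spec s : In s S -> N s /\ ~ BNT B N s /\ BNT B N (s * s).
Proof. by case: BN => _ [_ [_ [_ [H _]]]]; exact: H. Qed.
Let NS s : In s S -> N s. Proof. by move=> /S_spec []. Qed.

(** The lifts in [S] are involutions only modulo [T]. *)
Let B_invS s : In s S -> exists2 t, BNT B N t & s^-1 = s * t.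
Proof.
move=> /S_spec [Ns [_ [Bss Nss]]]; exists (s * s)^-1; last by grp.
by split; [exact: BV | exact: NV].
Qed.

Lemma pi1 : pi 1 = 1.
Proof. by apply/pi_ker. Qed.

Lemma piV x : N x -> pi x^-1 = (pi x)^-1.
Proof.
move=> Nx; symmetry; apply: ginv_uniq; rewrite -pi_mul //; last exact: NV.
by rewrite gmulVr pi1.
Qed.

Lemma Sg_invol w : Sg w -> w * w = 1.
Proof.
move=> /in_map_iff [s [<- Ss]]; have [Ns [_ H]] := S_spec s Ss.
by rewrite -pi_mul //; apply/pi_ker => //; case: H.
Qed.

Lemma Sg_neq1 s : In s S -> pi s <> 1.
Proof. by move=> /S_spec [Ns [H _]] /pi_ker E; apply/H/E. Qed.

Lemma Sg_inv w : Sg w -> w^-1 = w.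
Proof. by move=> Sw; apply/ginv_uniq/Sg_invol. Qed.

Lemma Sg_gen w : exists2 x, Forall Sg x & gprod x = w.
Proof.
have [n Nn <-] := pi_surj w.
case: BN => _ [_ [_ [_ [_ [/(_ n Nn) gen _]]]]].
suff [_] : N n /\ exists2 x, Forall Sg x & gprod x = pi n by [].
apply: (gen (fun n => N n /\ exists2 x, Forall Sg x & gprod x = pi n)).
  split; [|split].
  - by split=> //; exists []; rewrite ?pi1.
  - move=> a b [Na [x Fx Ex]] [Nb [y Fy Ey]]; split; first exact: NM.
    by exists (x ++ y); [apply/Forall_app | rewrite gprod_app Ex Ey pi_mul].
  - move=> a [Na [x Fx Ex]]; split; first exact: NV.
    exists (rev x); first exact: Forall_rev.
    rewrite piV // -Ex; elim: Fx => {x Ex} [|s x Ss _ IH] /=; first by rewrite ginv1.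
    by rewrite gprod_app ginvM IH /= gmulr1 (Sg_inv s).
move=> a [Sa|[Ba Na]].
  split; first exact: NS.
  by exists [pi a]; rewrite /= ?gmulr1 //; constructor=> //; apply: in_map.
by split=> //; exists [] => //=; symmetry; apply/pi_ker.
Qed.

Let len := word_length Sg.

Definition bruhat (w : W) (g : G) : Prop :=
  exists n, N n /\ pi n = w /\ dcoset B n g.

Lemma bruhatBl w b g : B b -> bruhat w g -> bruhat w (b * g).
Proof.
move=> Bb [n [Nn [En [b1 [b2 [Bb1 [Bb2 ->]]]]]]]; exists n; split=> //; split=> //.
by exists (b * b1), b2; split; [exact: BM | split=> //; grp].
Qed.

Lemma bruhatBr w b g : B b -> bruhat w g -> bruhat w (g * b).
Proof.
move=> Bb [n [Nn [En [b1 [b2 [Bb1 [Bb2 ->]]]]]]]; exists n; split=> //; split=> //.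
by exists b1, (b2 * b); split=> //; split; [exact: BM | grp].
Qed.

Lemma bruhatN n : N n -> bruhat (pi n) n.
Proof.
by move=> Nn; exists n; split=> //; split=> //; exists 1, 1; split=> //; split=> //; grp.
Qed.

Lemma bruhat1 b : B b -> bruhat 1 b.
Proof. by move=> Bb; rewrite -pi1 -(gmulr1 b); apply: bruhatBl => //; exact: bruhatN. Qed.

Lemma bruhat1_B g : bruhat 1 g -> B g.
Proof.
move=> [n [Nn [/pi_ker En [b1 [b2 [Bb1 [Bb2 ->]]]]]]].
by apply: BM => //; apply: BM => //; case: (En Nn).
Qed.

Lemma bruhatV w g : bruhat w g -> bruhat w^-1 g^-1.
Proof.
move=> [n [Nn [<- [b1 [b2 [Bb1 [Bb2 ->]]]]]]]; rewrite !ginvM -piV // gmulA.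
by apply: bruhatBr (BV _ Bb1) _; apply: bruhatBl (BV _ Bb2) _; apply/bruhatN/NV.
Qed.

Lemma bruhat_left s w g : In s S -> bruhat w g ->
  bruhat w (s * g) \/ bruhat (pi s * w) (s * g).
Proof.
move=> Ss [n [Nn [<- [b1 [b2 [Bb1 [Bb2 ->]]]]]]].
case: BN => _ [_ [_ [_ [_ [_ [/(_ s n b1 Ss Nn Bb1) ax _]]]]]].
rewrite !gmulA -(pi_mul _ _ (NS s Ss) Nn).
case: ax => H; [left | right]; apply: bruhatBr => //.
  by exists n.
by exists (s * n); split; [apply: NM => //; exact: NS | ].
Qed.

Lemma bruhat_right s w g : In s S -> bruhat w g ->
  bruhat w (g * s) \/ bruhat (w * pi s) (g * s).
Proof.
move=> Ss H; have Sp : Sg (pi s) by exact: in_map.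
have [t [Bt Nt] Et] := B_invS s Ss.
have -> : g * s = (s * (t * g^-1))^-1 by rewrite gmulA -Et; grp.
case: (bruhat_left s _ _ Ss (bruhatBl _ _ _ Bt (bruhatV _ _ H))) => /bruhatV.
  by rewrite ginvK; left.
by rewrite ginvM ginvK (Sg_inv (pi s)) //; right.
Qed.

Lemma G_ind (P : G -> Prop) : P 1 ->
  (forall g b, B b -> P g -> P (g * b)) ->
  (forall g s, In s S -> P g -> P (g * s)) -> forall g, P g.
Proof.
move=> P1 PB PS g; have PBE x b : B b -> P x <-> P (x * b).
  move=> Bb; split; first exact: PB.
  by move=> /(PB _ _ (BV _ Bb)); rewrite -gmulA gmulVr gmulr1.
(* The equivalence, rather than an implication, makes [H] closed under inverses. *)
pose H x := forall y, P y <-> P (y * x).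
have subH : is_subgroup H.
  split; [|split].
  - by move=> y; rewrite gmulr1.
  - by move=> a b Ha Hb y; rewrite gmulA -(Hb (y * a)); exact: Ha.
  - by move=> a Ha y; rewrite (Ha (y * a^-1)) -gmulA gmulV gmulr1.
case: BN => _ [_ [/(_ g) genG [_ [_ [genN _]]]]].
suff Hg : H g by rewrite -(gmul1 _ g) -(Hg 1).
apply: (genG H subH) => x [Bx|Nx]; first by move=> y; exact: PBE.
apply: (genN x Nx H subH) => a [Sa|[Ba _]]; last by move=> y; exact: PBE.
move=> y; split; first exact: PS.
move=> /(PS _ _ Sa); have [_ [_ [Baa _]]] := S_spec a Sa.
by rewrite -gmulA => /(PBE y _ Baa).
Qed.

Lemma bruhat_total g : exists w, bruhat w g.
Proof.
apply: (G_ind (fun g => exists w, bruhat w g)) => {g}.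
- by exists 1; exact: bruhat1.
- by move=> g b Bb [w Hw]; exists w; exact: bruhatBr.
- by move=> g s Ss [w /(bruhat_right s _ _ Ss) [H|H]]; [exists w | exists (w * pi s)].
Qed.

Lemma len_mulS_le w s : In s S -> len (pi s * w) <= Datatypes.S (len w).
Proof. by move=> Ss; apply: (word_length_mull_le _ Sg_invol Sg_gen); exact: in_map. Qed.

Lemma len_mulS_ge w s : In s S -> len w <= Datatypes.S (len (pi s * w)).
Proof.
move=> Ss; have := len_mulS_le (pi s * w) s Ss.
by rewrite gmulA Sg_invol ?gmul1 //; exact: in_map.
Qed.

Lemma SgK s w : In s S -> pi s * (pi s * w) = w.
Proof. by move=> Ss; rewrite gmulA Sg_invol ?gmul1 //; exact: in_map. Qed.

Lemma len_desc_left w : w <> 1 -> exists2 s, In s S & len w = Datatypes.S (len (pi s * w)).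
Proof.
move=> w1; have [|s' [Ss]] := word_length_desc _ Sg_invol Sg_gen w^-1.
  by move=> E; apply: w1; rewrite -(ginvK w) E ginv1.
have := Ss => /in_map_iff [s [<- Is]].
rewrite (word_length_inv _ Sg_invol Sg_gen) => E; exists s => //.
rewrite /len E -(word_length_inv _ Sg_invol Sg_gen (w^-1 * pi s)).
by rewrite ginvM ginvK Sg_inv //; exact: in_map.
Qed.

(** Strip a left descent [s] of the shorter [w]. If the element did not leave the cell of [w'],
    induction would give [w' = pi s * w], too short. *)
Lemma bruhat_uniq_le w w' g : len w <= len w' -> bruhat w g -> bruhat w' g -> w = w'.
Proof.
move En: (len w) => n; elim: n w w' g En => [|n IH] w w' g En le Hw Hw'.
  have w1 : w = 1 by apply/(word_length0 _ Sg_gen).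
  rewrite w1 in Hw *; have Bg := bruhat1_B _ Hw.
  case: Hw' => [m [Nm [<- [b1 [b2 [Bb1 [Bb2 Eg]]]]]]]; symmetry; apply/pi_ker => //.
  split=> //; have -> : m = b1^-1 * g * b2^-1 by rewrite Eg; grp.
  by apply: BM; [apply: BM => //; exact: BV | exact: BV].
have [|s Ss Es] := len_desc_left w.
  by move=> E; move: En; rewrite E /len (proj2 (word_length0 _ Sg_gen 1)).
case: Hw => [m [Nm [Em [b1 [b2 [Bb1 [Bb2 Eg]]]]]]].
have Hw1 : bruhat (pi s * w) (s * (b1^-1 * g)).
  rewrite Eg -Em -pi_mul //; last exact: NS.
  have -> : s * (b1^-1 * (b1 * m * b2)) = s * m * b2 by grp.
  by apply: bruhatBr => //; apply: bruhatN; apply: NM => //; exact: NS.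
have L : len (pi s * w) = n by lia.
case: (bruhat_left s _ _ Ss (bruhatBl _ _ _ (BV _ Bb1) Hw')) => H.
  have le1 : n <= len w' by lia.
  by have E := IH _ _ _ L le1 Hw1 H; move: L; rewrite E; lia.
have le1 : n <= len (pi s * w') by have := len_mulS_ge w' s Ss; lia.
have E := IH _ _ _ L le1 Hw1 H.
by rewrite -(SgK s w Ss) E SgK.
Qed.

Lemma bruhat_uniq w w' g : bruhat w g -> bruhat w' g -> w = w'.
Proof.
move=> H H'; have [le|le] := Nat.le_ge_cases (len w) (len w').
  exact: bruhat_uniq_le H H'.
by symmetry; exact: bruhat_uniq_le H' H.
Qed.

(** Write [w = v * pi r] with [v] shorter. By induction [s * g] lies in the cell of [pi s * v] or of
    [pi s * w]; were it also in the cell of [w], either [pi s * w = v] would be shorter than [w], or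
    [pi s = 1]. *)
Lemma bruhat_ascent s w g : In s S -> len w <= len (pi s * w) ->
  bruhat w g -> bruhat (pi s * w) (s * g).
Proof.
move=> Ss; move En: (len w) => n; elim: n w g En => [|n IH] w g En le Hw.
  have w1 : w = 1 by apply/(word_length0 _ Sg_gen).
  rewrite w1 in Hw *; rewrite gmulr1; apply: bruhatBr; first exact: bruhat1_B.
  exact/bruhatN/NS.
have w1 : w <> 1 by move=> E; move: En; rewrite E /len (proj2 (word_length0 _ Sg_gen 1)).
have [r' [/in_map_iff [r [<- Sr]] Er]] := word_length_desc _ Sg_invol Sg_gen w w1.
have Sr' : Sg (pi r) by exact: in_map.
set v := w * pi r in Er; have Ew : w = v * pi r by rewrite /v -gmulA Sg_invol // gmulr1.
have le' : len v <= len (pi s * v).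
  apply: NNPP => H; have := word_length_mulr_le _ Sg_gen (pi s * v) _ Sr'.
  by move: le H Er; rewrite -gmulA -Ew -/len -En; lia.
case: (Hw) => [m [Nm [Em [b1 [b2 [Bb1 [Bb2 Eg]]]]]]].
pose h := b1 * (m * r^-1).
have Hh : bruhat v h.
  have Nr := NV _ (NS r Sr).
  have Er' : pi r^-1 = pi r by rewrite (piV r (NS r Sr)) Sg_inv.
  by apply: bruhatBl => //; rewrite /v -Em -Er' -pi_mul //; apply/bruhatN/NM.
have Lv : len v = n by move: Er; rewrite -/len En; lia.
rewrite Lv in le'; have Hsh := IH v h Lv le' Hh.
have Egh : s * g = s * h * r * b2 by rewrite /h Eg; grp.
case: (bruhat_left s _ _ Ss Hw) => // H; exfalso.
case: (bruhat_right r _ _ Sr Hsh) => /(bruhatBr _ _ _ Bb2); rewrite -Egh => H'.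
  have E := bruhat_uniq _ _ _ H H'.
  by move: le; rewrite E SgK // Lv; lia.
have E := bruhat_uniq _ _ _ H H'; move: E; rewrite -gmulA -Ew => E.
by apply: (Sg_neq1 s Ss); apply: (gmul_injr w); rewrite -E gmul1.
Qed.

Lemma thick s : In s S -> exists2 b, B b & bruhat (pi s) (s * b * s).
Proof.
move=> Ss; apply: NNPP => H.
case: BN => _ [_ [_ [_ [_ [_ [_ /(_ s Ss) ax]]]]]]; apply: ax.
have sub b : B b -> B (s * b * s).
  move=> Bb; apply: NNPP => NB; apply: H; exists b => //.
  have Hs := bruhatBl _ _ _ Bb (bruhatN s (NS s Ss)).
  case: (bruhat_left s _ _ Ss Hs); rewrite gmulA // Sg_invol; last exact: in_map.
  by move/bruhat1_B.
move=> x; split; first by move=> [b [Bb ->]]; exact: sub.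
move=> Bx; have [t [Bt Nt] Et] := B_invS s Ss.
have Et' : s^-1 = t * s.
  apply: (gmul_injl s); rewrite gmulVr gmulA -Et gmulV //.
have sB := sub x Bx.
exists (s^-1 * x * s^-1); split; last by grp.
have -> : s^-1 * x * s^-1 = t * (s * x * s) * t by rewrite {1}Et' {1}Et; grp.
by apply: BM => //; apply: BM.
Qed.

Lemma bruhat_descent s w n : In s S -> len (pi s * w) <= len w -> N n -> pi n = w ->
  exists2 b, B b & bruhat w (s * b * n).
Proof.
move=> Ss le Nn En; have [b Bb [m [Nm [Em [b1 [b2 [Bb1 [Bb2 Eb]]]]]]]] := thick s Ss.
exists b => //.
have [k [Nk Ek]] : exists k, N k /\ n = s * k.
  by exists (s^-1 * n); split; [apply: NM => //; apply/NV/NS | grp].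
have Hk : bruhat (pi s * w) k.
  have -> : pi s * w = pi k by rewrite -En Ek pi_mul ?SgK //; exact: NS.
  exact: bruhatN.
have -> : s * b * n = b1 * (s * (s^-1 * m * b2 * k)).
  by rewrite Ek gmulA Eb; grp.
apply: bruhatBl => //; rewrite -{1}(SgK s w Ss).
apply: bruhat_ascent; rewrite ?SgK //; apply: bruhatBl => //; apply: BM => //.
suff [] : BNT B N (s^-1 * m) by [].
have Ns := NS s Ss; have NVs := NV s Ns.
by apply/pi_ker; [exact: NM | rewrite pi_mul // piV // Em gmulV].
Qed.

(** The BN-axioms supply no parity. Equal lengths would let ascent and descent apply to the same
    element and put it in two cells. *)
Lemma len_neq s w : In s S -> len (pi s * w) <> len w.
Proof.
move=> Ss E; have [n Nn En] := pi_surj w.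
have [|b Bb H] := bruhat_descent s w n Ss _ Nn En; first by lia.
have Hn : bruhat w (b * n) by rewrite -En; apply/bruhatBl/bruhatN.
have := bruhat_ascent s w _ Ss _ Hn; rewrite gmulA => H'.
have E' := bruhat_uniq _ _ _ H (H' ltac:(lia)).
by apply: (Sg_neq1 s Ss); apply: (gmul_injr w); rewrite -E' gmul1.
Qed.

Lemma bn_coxeter_length : coxeter_length Sg len.
Proof.
have lenV := word_length_inv _ Sg_invol Sg_gen.
split.
- exact: Sg_invol.
- exact: word_length0 _ Sg_gen.
- move=> w s' Ss'; have [s [Es Ss]] := proj1 (in_map_iff _ _ _) Ss'.
  have Ew : len (w * s') = len (pi s * w^-1).
    by rewrite /len -lenV ginvM (Sg_inv _ Ss') Es.
  rewrite Ew; have := len_neq s w^-1 Ss; have := len_mulS_le w^-1 s Ss.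
  by have := len_mulS_ge w^-1 s Ss; rewrite /len lenV; lia.
- exact: word_length_desc _ Sg_invol Sg_gen.
- exact: lenV.
move=> s' w r' Ss' Sr' E1 E2.
have [s [Es Ss]] := proj1 (in_map_iff _ _ _) Ss'.
have [r [Er Sr]] := proj1 (in_map_iff _ _ _) Sr'.
rewrite -Es -Er in E1 E2 *; have [n Nn En] := pi_surj w.
have Nr := NS r Sr.
have Enr : pi (n * r) = w * pi r by rewrite pi_mul // En.
(* Folding: descent puts [s * b * (n * r)] in the cell of [w * pi r]; ascent followed by right
   multiplication by [r] puts it in the cell of [pi s * w] or of [pi s * w * pi r], and the latter
   would give [pi s = 1]. *)
have [|b Bb H] := bruhat_descent s (w * pi r) (n * r) Ss _ (NM _ _ Nn Nr) Enr.
  by rewrite gmulA; lia.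
have Hn : bruhat w (b * n) by rewrite -En; apply/bruhatBl/bruhatN.
have H' := bruhat_ascent s w _ Ss ltac:(lia) Hn.
have Eg : s * b * (n * r) = s * (b * n) * r by grp.
rewrite Eg in H; case: (bruhat_right r _ _ Sr H') => H2.
  exact: bruhat_uniq H2 H.
have := bruhat_uniq _ _ _ H H2; rewrite -gmulA => E.
by case: (Sg_neq1 s Ss); apply: (gmul_injr (w * pi r)); rewrite -E gmul1.
Qed.

(** The Weyl distance from the chamber [B] to the chamber [g B]. *)
Definition delta (g : G) : W := proj1_sig (constructive_indefinite_description _ (bruhat_total g)).

Lemma deltaP g : bruhat (delta g) g.
Proof. by rewrite /delta; case: constructive_indefinite_description. Qed.

Lemma delta_eq g w : bruhat w g -> delta g = w.
Proof. exact/bruhat_uniq/deltaP. Qed.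

Lemma deltaBl b g : B b -> delta (b * g) = delta g.
Proof. by move=> Bb; apply: delta_eq; apply: bruhatBl => //; exact: deltaP. Qed.

Lemma deltaBr g b : B b -> delta (g * b) = delta g.
Proof. by move=> Bb; apply: delta_eq; apply: bruhatBr => //; exact: deltaP. Qed.

Lemma deltaN n : N n -> delta n = pi n.
Proof. by move=> Nn; apply: delta_eq; exact: bruhatN. Qed.

Lemma delta_left s g : In s S -> delta (s * g) = delta g \/ delta (s * g) = pi s * delta g.
Proof.
move=> Ss; case: (bruhat_left s _ _ Ss (deltaP g)) => /delta_eq; by [left | right].
Qed.

Lemma delta_right s g : In s S -> delta (g * s) = delta g \/ delta (g * s) = delta g * pi s.
Proof.
move=> Ss; case: (bruhat_right s _ _ Ss (deltaP g)) => /delta_eq; by [left | right].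
Qed.

(** A letter of [r] from [B] leaves the list unchanged, and one from [S] at most doubles it. *)
Lemma left_displacement_finite r : exists l, forall g, In (delta (r * g) * (delta g)^-1) l.
Proof.
elim/G_ind: r => [|r b Bb [l Hl]|r s Ss [l Hl]].
- by exists [1] => g; left; rewrite gmul1; grp.
- by exists l => g; rewrite -gmulA -(deltaBl b g Bb); exact: Hl.
exists (l ++ map (fun x => x * pi s) l) => g; rewrite -gmulA; apply/in_or_app.
case: (delta_left s g Ss) (Hl (s * g)) => -> H; [by left | right].
apply/in_map_iff; exists (delta (r * (s * g)) * (pi s * delta g)^-1); split=> //.
by rewrite ginvM (Sg_inv (pi s)); [grp; rewrite Sg_invol; grp | ]; exact: in_map.
Qed.

(** * Retraction from an end and the homomorphism on the centralizer *)

Section Retraction.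
Context {U : (nat -> Prop) -> Prop} (UF : ultrafilter U) {n : G} (Nn : N n).
Let w := pi n.
Let fluxw := flux (len := len) (U := U) w.
Let CL := bn_coxeter_length.

Lemma pi_pow k : N (n ^ k) /\ pi (n ^ k) = w ^ k.
Proof.
elim: k => [|k [IH1 IH2]] /=; first by split; [|exact: pi1].
by split; [exact: NM | rewrite pi_mul ?IH2].
Qed.

(* The retraction onto the apartment of [N] centred at the repelling end of [n]; since [w] need not
   be straight, the sequence may fail to stabilize, whence the ultralimit. *)
Let approx (p : G) (J : nat) : W := (w ^ J)^-1 * delta (n ^ J * p).

(** For each [J], appending [s] multiplies [approx] by 1 or by [pi s]; the ultrafilter decides
    which. *)
Lemma retract_ulim p : exists v, ulim (U := U) (approx p) v.
Proof.
elim/G_ind: p => [|p b Bb [v Hv]|p s Ss [v Hv]].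
- exists 1; apply: (uf_all UF) => J; rewrite /approx gmulr1.
  by have [NJ EJ] := pi_pow J; rewrite deltaN // EJ gmulV.
- exists v; apply: (ulim_ext UF) Hv; apply: (uf_all UF) => J.
  by rewrite /approx gmulA (deltaBr (n ^ J * p) b).
case: (uf_or U UF (fun J => approx (p * s) J = approx p J)) => E.
  by exists v; apply: (ulim_ext UF) Hv; apply: (uf_sup U UF _ _ E) => J ->.
exists (v * pi s); apply: (uf_sup U UF _ _ (uf_and U UF _ _ E Hv)) => J [ne <-].
move: ne; rewrite /approx gmulA.
by case: (delta_right s (n ^ J * p) Ss) => -> //; rewrite gmulA.
Qed.

Definition retract (p : G) : W := epsilon (inhabits 1) (ulim (U := U) (approx p)).

Lemma retractP p : ulim (U := U) (approx p) (retract p).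
Proof. exact: (epsilon_spec (inhabits (1 : W)) _ (retract_ulim p)). Qed.

Lemma retract_eq p v : U (fun J => approx p J = v) -> retract p = v.
Proof. by move=> H; apply: (ulim_uniq UF) (retractP p) H. Qed.

Lemma retract_N m : N m -> retract m = pi m.
Proof.
move=> Nm; apply: retract_eq; apply: (uf_all UF) => J; rewrite /approx.
have [NJ EJ] := pi_pow J; rewrite deltaN; last exact: NM.
by rewrite pi_mul // EJ gmulKl.
Qed.

Lemma retractB p b : B b -> retract (p * b) = retract p.
Proof.
move=> Bb; apply: retract_eq; apply: (ulim_ext UF) (retractP p).
by apply: (uf_all UF) => J; rewrite /approx gmulA (deltaBr (n ^ J * p) b).
Qed.

Lemma retractS p s : In s S ->
  retract (p * s) = retract p \/ retract (p * s) = retract p * pi s.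
Proof.
move=> Ss; case: (uf_or U UF (fun J => approx (p * s) J = approx p J)) => E; [left | right].
  apply: retract_eq; apply: (uf_sup U UF _ _ (uf_and U UF _ _ E (retractP p))).
  by move=> J [-> ->].
apply: retract_eq; apply: (uf_sup U UF _ _ (uf_and U UF _ _ E (retractP p))) => J [ne <-].
move: ne; rewrite /approx gmulA.
by case: (delta_right s (n ^ J * p) Ss) => -> //; rewrite gmulA.
Qed.

Definition shift r p : W := retract (r * p) * (retract p)^-1.

(** As [r] commutes with [n], conjugating the shift by [w ^ J] gives the displacement of [n ^ J * p]
    by [r]. There are finitely many displacements, so two conjugates agree. *)
Lemma shift_virt_central r p : r * n = n * r -> virt_central w (shift r p).
Proof.
move=> E; have [l Hl] := left_displacement_finite r.
have [|i [j [ij Eij]]] := ulim_pigeonhole UF l (fun J => w ^ J * shift r p * (w ^ J)^-1).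
  apply: (uf_sup U UF _ _ (uf_and U UF _ _ (retractP (r * p)) (retractP p))).
  move=> J [E1 E2]; have := Hl (n ^ J * p).
  have -> : r * (n ^ J * p) = n ^ J * (r * p).
    by rewrite gmulA (comm_pow r n J) // -gmulA.
  suff -> : delta (n ^ J * (r * p)) * (delta (n ^ J * p))^-1 =
    w ^ J * shift r p * (w ^ J)^-1 by [].
  by rewrite /shift -E1 -E2 /approx; grp.
exact: conj_eq_virt_central ij Eij.
Qed.

Lemma retract1 : retract 1 = 1.
Proof. by rewrite retract_N // pi1. Qed.

Lemma shift1 r : shift r 1 = retract r.
Proof. by rewrite /shift retract1 gmulr1; grp. Qed.

(** Passing from [p] to an adjacent chamber changes the shift only when exactly one of the two
    retractions crosses a wall. *)
Lemma flux_shift r p : r * n = n * r -> fluxw (shift r p) = fluxw (retract r).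
Proof.
move=> E; elim/G_ind: p => [|p b Bb <-|p s Ss <-]; first by rewrite shift1.
  by rewrite /shift gmulA (retractB (r * p)) // (retractB p).
have Sp : Sg (pi s) by exact: in_map.
have V := shift_virt_central r p E; have V' := shift_virt_central r (p * s) E.
suff flip : shift r (p * s) = retract (r * p) * pi s * (retract p)^-1 ->
    fluxw (shift r (p * s)) = fluxw (shift r p).
  have := flip; rewrite /shift gmulA.
  case: (retractS (r * p) s Ss) => ->; case: (retractS p s Ss) => -> //; last first.
  - by move=> _; congr fluxw; rewrite ginvM (Sg_inv _ Sp); grp; rewrite (genK CL).
  - by apply.
  - by apply; rewrite ginvM (Sg_inv _ Sp) gmulA.
(* The two values differ by the reflection [t], which lies in the centralizer and has no flux. *)
move=> Es; pose t := retract (r * p) * pi s * (retract (r * p))^-1.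
have Et : shift r (p * s) = t * shift r p by rewrite Es /t /shift; grp.
have Vt : virt_central w t.
  have -> : t = shift r (p * s) * (shift r p)^-1 by rewrite Et; grp.
  by apply: virt_centralM V' (virt_centralV _ _ V).
have tt : t * t = 1 by rewrite /t; grp; rewrite (genK CL) //; grp.
by rewrite Et /fluxw (flux_mul CL w UF) // (flux_involution CL w UF).
Qed.

Definition psi r : Z := fluxw (retract r).

Lemma psi_mul r r' : r * n = n * r -> r' * n = n * r' -> psi (r * r') = (psi r + psi r')%Z.
Proof.
move=> E E'; rewrite /psi -(flux_shift r r' E) /fluxw -(flux_mul CL w UF).
  by rewrite /shift; grp.
exact: shift_virt_central.
Qed.

Lemma psi_neq0 (gens : list W) : (forall s, Sg s <-> In s gens) ->
  (forall k, 0 < k -> w ^ k <> 1) -> psi n <> 0%Z.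
Proof. by move=> Hg inf; rewrite /psi retract_N //; apply: (flux_self_neq0 CL Hg w UF). Qed.

End Retraction.
End BNPair.

(** * Compact groups *)

Section CompactGroup.
Context {G : TopGroup} (HG : hausdorff G) (CG : compact G).
Context {U : (nat -> Prop) -> Prop} (UF : ultrafilter U).

Definition top_ulim (x : nat -> G) (l : G) : Prop :=
  forall O, is_open G O -> O l -> U (fun J => O (x J)).

(** Otherwise the open sets that almost all [x J] avoid cover [G], and finitely many of them already
    do. *)
Lemma top_ulim_ex x : exists l, top_ulim x l.
Proof.
apply: NNPP => H.
pose I := {O : G -> Prop | is_open G O /\ ~ U (fun J => O (x J))}.
have [|p|l Hl] := CG I (fun i => proj1_sig i).
- by case=> O [].
- apply: NNPP => N; apply: H; exists p => O oO Op; apply: NNPP => NU.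
  by apply: N; exists (exist _ O (conj oO NU)).
have : U (fun J => forall i, In i l -> ~ proj1_sig i (x J)).
  elim: l {Hl} => [|i l IH]; first by apply: (uf_all UF) => J i [].
  have Hi : U (fun J => ~ proj1_sig i (x J)).
    by case: (uf_or U UF (fun J => proj1_sig i (x J))) => // Ui; case: (proj2_sig i) => _ [].
  apply: (uf_sup U UF _ _ (uf_and U UF _ _ IH Hi)) => J [H1 H2] k [<-|] //.
  exact: H1.
by move=> /(uf_ex U UF) [J HJ]; have [i [il Hi]] := Hl (x J); apply: (HJ i).
Qed.

Lemma top_ulim_uniq x l l' : top_ulim x l -> top_ulim x l' -> l = l'.
Proof.
move=> H H'; apply: NNPP => ne; have [O [O' [oO [oO' [Ol [O'l D]]]]]] := HG l l' ne.
have [J [HJ HJ']] := uf_ex U UF _ (uf_and U UF _ _ (H O oO Ol) (H' O' oO' O'l)).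
exact: D HJ HJ'.
Qed.

Lemma top_ulim_ext x y l : U (fun J => x J = y J) -> top_ulim x l -> top_ulim y l.
Proof.
move=> E H O oO Ol; apply: (uf_sup U UF _ _ (uf_and U UF _ _ E (H O oO Ol))).
by move=> J [<-].
Qed.

Lemma top_ulim_cst l : top_ulim (fun _ => l) l.
Proof. by move=> O oO Ol; apply: (uf_all UF). Qed.

Lemma top_ulim_mul x y l m : top_ulim x l -> top_ulim y m ->
  top_ulim (fun J => x J * y J) (l * m).
Proof.
move=> Hx Hy O oO Olm.
have [V [V' [oV [oV' [Vl [V'm H]]]]]] := mul_continuous G O l m oO Olm.
apply: (uf_sup U UF _ _ (uf_and U UF _ _ (Hx V oV Vl) (Hy V' oV' V'm))).
by move=> J [HV HV']; apply: H.
Qed.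

Lemma top_ulim_pow x l k : top_ulim x l -> top_ulim (fun J => x J ^ k) (l ^ k).
Proof.
by move=> H; elim: k => [|k IH] /=; [exact: top_ulim_cst | exact: top_ulim_mul].
Qed.

Lemma top_ulim_comm (n : G) (e : nat -> nat) l : top_ulim (fun J => n ^ e J) l ->
  l * n = n * l.
Proof.
move=> H; have H1 := top_ulim_mul _ _ _ _ H (top_ulim_cst n).
have H2 := top_ulim_mul _ _ _ _ (top_ulim_cst n) H.
apply: (top_ulim_uniq _ _ _ H1); apply: top_ulim_ext H2.
by apply: (uf_all UF) => J; apply: comm_pow.
Qed.

(** The root is a limit of [n ^ (e J / m)], so it commutes with [n] and stays in the domain of the
    homomorphism. *)
Lemma top_ulim_root (n : G) (e : nat -> nat) l m :
  top_ulim (fun J => n ^ e J) l -> 0 < m ->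
  (exists K, forall J, K <= J -> Nat.divide m (e J)) ->
  exists2 r, r * n = n * r & r ^ m = l.
Proof.
move=> H m0 [K HK]; have [r Hr] := top_ulim_ex (fun J => n ^ (e J / m)).
exists r; first exact: top_ulim_comm Hr.
apply: (top_ulim_uniq _ _ _ (top_ulim_pow _ _ m Hr)); apply: top_ulim_ext H.
apply: (uf_sup U UF _ _ (uf_tail U UF K)) => J /HK [q ->].
by rewrite Nat.div_mul ?gpow_mul //; lia.
Qed.

Lemma top_ulim_hom_eq0 (n : G) (phi : G -> Z) (e : nat -> nat) l m : 1 < m ->
  (forall r k, r * n = n * r -> phi (r ^ k) = (Z.of_nat k * phi r)%Z) ->
  (forall k, exists K, forall J, K <= J -> Nat.divide (m ^ k)%nat (e J)) ->
  top_ulim (fun J => n ^ e J) l -> phi l = 0%Z.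
Proof.
(* [phi l] is divisible by all powers of [m]; the exponent [k] already gives one exceeding its
   absolute value. *)
move=> m1 Hphi He Hl; pose k := Z.to_nat (Z.abs (phi l)).
have lt : k < (m ^ k)%nat by apply: Nat.pow_gt_lin_r.
have [|r Cr Er] := top_ulim_root n e l (m ^ k)%nat Hl _ (He k); first by lia.
move: (Hphi r (m ^ k)%nat Cr); rewrite Er => E.
have [E0|] : phi r = 0%Z \/ (1 <= Z.abs (phi r))%Z by lia.
  by rewrite E E0; lia.
by move=> ge; have : (Z.abs (phi l) = Z.of_nat (m ^ k)%nat * Z.abs (phi r))%Z; nia.
Qed.

End CompactGroup.

(** * The exponents, and the conclusion *)

Lemma four_pow J : exists y, (4 ^ (3 ^ J) = 1 + 3 ^ S J * y)%nat.
Proof.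
elim: J => [|J [y E]]; first by exists 1%nat.
rewrite Nat.pow_succ_r' Nat.mul_comm Nat.pow_mul_r E.
(* The cube of [1 + 3 ^ S J * y], minus 1, divided by [3 ^ S (S J)]. *)
exists (y + 3 ^ S J * y * y + 3 ^ S J * 3 ^ J * y * y * y)%nat.
rewrite (Nat.pow_succ_r' 3 (S J)) /=; ring.
Qed.

Lemma pow_divide_pow m i j : i <= j -> Nat.divide (m ^ i)%nat (m ^ j)%nat.
Proof.
move=> ij; exists (m ^ (j - i))%nat; rewrite -Nat.pow_add_r; congr Nat.pow; lia.
Qed.

Lemma two_pow_divide k J : k <= J -> Nat.divide (2 ^ k)%nat (4 ^ (3 ^ J))%nat.
Proof.
move=> kJ; rewrite -[4%nat]/(2 ^ 2)%nat -Nat.pow_mul_r; apply: pow_divide_pow.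
by have := Nat.pow_gt_lin_r 3 J ltac:(lia); lia.
Qed.

Lemma three_pow_divide k J : k <= J -> Nat.divide (3 ^ k)%nat (4 ^ (3 ^ J) - 1)%nat.
Proof.
move=> kJ; have [y ->] := four_pow J; apply: (Nat.divide_trans _ (3 ^ S J)%nat).
  by apply: pow_divide_pow; lia.
by exists y; lia.
Qed.

Lemma compact_hom_eq0 (G : TopGroup) (HG : hausdorff G) (CG : compact G) (n : G) (phi : G -> Z) :
  (forall r r', r * n = n * r -> r' * n = n * r' -> phi (r * r') = (phi r + phi r')%Z) ->
  phi n = 0%Z.
Proof.
move=> phiM; have [U UF] := ultrafilter_exists.
have phi1 : phi 1 = 0%Z.
  by have := phiM 1 1; rewrite !gmul1 gmulr1 => /(_ eq_refl eq_refl); lia.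
have phiX r k : r * n = n * r -> phi (r ^ k) = (Z.of_nat k * phi r)%Z.
  move=> E; elim: k => [|k IH]; first exact: phi1.
  by rewrite Nat2Z.inj_succ /= phiM // ?IH; [lia | symmetry; apply: comm_pow].
have [b Hb] := top_ulim_ex CG UF (fun J => n ^ (4 ^ (3 ^ J) - 1)%nat).
have Ha : top_ulim (U := U) (fun J => n ^ (4 ^ (3 ^ J))%nat) (n * b).
  apply: top_ulim_ext (top_ulim_mul UF _ _ _ _ (top_ulim_cst UF n) Hb) => //.
  apply: (uf_all UF) => J; rewrite -/(gpow n (S (4 ^ 3 ^ J - 1))); congr gpow.
  by have := Nat.pow_nonzero 4 (3 ^ J)%nat; lia.
have E : phi (n * b) = 0%Z.
  apply: (top_ulim_hom_eq0 HG CG UF n phi _ _ 2 _ phiX _ Ha); first by lia.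
  by move=> k; exists k => J; exact: two_pow_divide.
have E' : phi b = 0%Z.
  apply: (top_ulim_hom_eq0 HG CG UF n phi _ _ 3 _ phiX _ Hb); first by lia.
  by move=> k; exists k => J; exact: three_pow_divide.
by move: E; rewrite phiM ?E' //; [lia | exact: (top_ulim_comm HG UF _ _ _ Hb)].
Qed.

Theorem theorem1 (G : TopGroup) (HG : hausdorff G) (CG : compact G)
  (B N : G -> Prop) (S : list G) :
  is_BN_pair B N S -> spherical B N.
Proof.
move=> BN; have [subB [subN [_ [normT _]]]] := BN.
have subT : is_subgroup (BNT B N).
  case: subB subN => [B1 [BM BV]] [N1 [NM NV]]; split; [|split].
  - by split.
  - by move=> x y [? ?] [? ?]; split; [apply: BM | apply: NM].
  - by move=> x [? ?]; split; [apply: BV | apply: NV].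
have TN x : BNT B N x -> N x by case.
have [W [pi [pi_mul [pi_ker pi_surj]]]] := quotient_exists N (BNT B N) subN subT TN normT.
pose eq_decW (x y : W) : {x = y} + {x <> y} := excluded_middle_informative (x = y).
(* [S] may contain several lifts of one reflection, whereas a turn of the game must fire each node
   once. *)
pose gens := nodup eq_decW (map pi S).
have Ugens : NoDup gens by exact: NoDup_nodup.
have Hgens s : Sg (S := S) (pi := pi) s <-> In s gens by rewrite /gens nodup_In.
have CL := bn_coxeter_length BN pi_mul pi_ker pi_surj.
have [h [h0 Eh]] : exists h, 0 < h /\ coxeter_element (gens := gens) ^ h = 1.
  apply: NNPP => inf; have [n Nn En] := pi_surj (coxeter_element (gens := gens)).
  have [U UF] := ultrafilter_exists.
  apply: (psi_neq0 BN pi_mul pi_ker pi_surj UF Nn gens Hgens).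
    by rewrite En => k k0 Ek; apply: inf; exists k.
  by apply: compact_hom_eq0 => //; exact: psi_mul.
have [M HM] := finite_order_bounded CL Hgens Ugens h h0 Eh.
have [l Hl] := ball_finite CL gens Hgens M.
pose lift (w : W) : G := epsilon (inhabits 1) (fun x => N x /\ pi x = w).
exists (map lift l) => n Nn; exists (lift (pi n)).
have [NL EL] : N (lift (pi n)) /\ pi (lift (pi n)) = pi n.
  by apply: (epsilon_spec (inhabits 1) (fun x => N x /\ pi x = pi n)); exists n.
have NV : N (lift (pi n))^-1 by case: subN => _ [_ H]; exact: H.
split; first by apply: in_map; apply: Hl; exact: HM.
split=> //; apply/pi_ker; first by case: subN => _ [H _]; exact: H.
by rewrite pi_mul // (piV BN pi_mul pi_ker) // EL gmulV.
Qed.
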